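(* Let $F$ be a non-empty forest, and write $\tilde\Delta(F)=\sum_{(F)}F^{(1)}\otimes F^{(2)}$. Then $$\pi_1(F)=F-\sum_{(F)}F^{(1)}\top\pi_1(F^{(2)}),$$ where the sum is understood via the linear map $x\otimes y\mapsto x\top\pi_1(y)$.
   Context: ${\cal H}_R$ is the commutative polynomial algebra over $\mathbb{Q}$ on isomorphism classes of rooted trees (finite connected simply connected graphs with a root, edges oriented away from the root; weight = number of vertices); monomials are forests, $1$ is the empty forest. Coproduct: the algebra morphism with $\Delta(t)=1\otimes t+t\otimes1+\sum_CP^C(t)\otimes R^C(t)$ over admissible cuts $C$ of $t$ (nonempty edge sets meeting each root-to-vertex path at most once; $R^C(t)$ = component containing the root, $P^C(t)$ = product of the others). $\tilde\Delta(x)=\Delta(x)-1\otimes x-x\otimes1$; $Prim({\cal H}_R)=\ker\tilde\Delta$. For forests $M,N$: $M\top N=0$ if $N=1$, else $\frac{1}{weight(N)}\sum_vN_v$, $v$ over vertices of $N$, $N_v$ obtained from $N$ by attaching every tree of $M$ to $v$; bilinear extension. $F_i:Prim({\cal H}_R)^{\otimes i}\to{\cal H}_R$, $p_i\otimes\cdots\otimes p_1\mapsto(\cdots(p_i\top p_{i-1})\cdots)\top p_1$; $F_1$ is the inclusion, so $Im(F_1)=Prim({\cal H}_R)$. One has ${\cal H}_R=\mathbb{Q}1\oplus\bigoplus_{j\ge1}Im(F_j)$, and $\pi_1$ is the projection onto $Im(F_1)$ vanishing on $\mathbb{Q}1\oplus\bigoplus_{j\ge2}Im(F_j)$. *)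

(* Defs.v *)
From HB Require Import structures.
From mathcomp Require Import all_boot all_order all_algebra.
From mathcomp Require Import finmap.
From mathcomp Require Import monalg.

Set Implicit Arguments.
Unset Strict Implicit.
Unset Printing Implicit Defensive.

Import GRing.Theory.
Local Open Scope ring_scope.

Inductive rtree := RNode of seq rtree.

Fixpoint rtree_enc (t : rtree) : GenTree.tree unit :=
  let: RNode ts := t in GenTree.Node 0 (map rtree_enc ts).

Fixpoint rtree_dec (t : GenTree.tree unit) : option rtree :=
  match t with
  | GenTree.Leaf _ => None
  | GenTree.Node _ ts => Some (RNode (pmap rtree_dec ts))
  end.

Lemma rtree_encK : pcancel rtree_enc rtree_dec.
Proof.
rewrite /pcancel; fix IH 1; move=> -[ts] /=; congr (Some (RNode _)).
by elim: ts => //= t ts IHts; rewrite IH /= IHts.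
Qed.

HB.instance Definition _ := Countable.copy rtree (pcan_type rtree_encK).

(* Isomorphism classes of rooted trees: canonical representatives,    *)
(* obtained by recursively sorting the children (w.r.t. the injective *)
(* encoding [pickle]).  Two planar rooted trees are isomorphic (as    *)
(* rooted trees) iff they have the same canonical form.               *)
Definition rtree_le (a b : rtree) : bool := (choice.pickle a <= choice.pickle b)%N.

Fixpoint canon (t : rtree) : rtree :=
  let: RNode ts := t in RNode (sort rtree_le (map canon ts)).

Lemma rtree_ind2 (P : rtree -> Prop) :
  (forall ts, (forall x, x \in ts -> P x) -> P (RNode ts)) -> forall t, P t.
Proof.
move=> H; fix IH 1; move=> -[ts]; apply: H.
elim: ts => [|t ts IHts] x.
  rewrite in_nil => F; case: (notF F).
have Pt := IH t; rewrite in_cons => /orP[/eqP->|Hx]; [exact: Pt | exact: IHts x Hx].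
Qed.

Lemma rtree_le_trans : transitive rtree_le.
Proof. by move=> a b c; rewrite /rtree_le; apply: leq_trans. Qed.

Lemma rtree_le_total : total rtree_le.
Proof. by move=> a b; rewrite /rtree_le leq_total. Qed.

Lemma canon_idem (t : rtree) : canon (canon t) = canon t.
Proof.
elim/rtree_ind2: t => ts IH /=; congr RNode.
have -> : map canon (sort rtree_le (map canon ts)) = sort rtree_le (map canon ts).
  by apply: map_id_in => x; rewrite mem_sort => /mapP[y /IH ? ->].
by apply: sorted_sort; [exact: rtree_le_trans | exact: sort_sorted rtree_le_total _].
Qed.

Definition ctree := {t : rtree | canon t == t}.

Definition mkct (t : rtree) : ctree := exist _ (canon t) (introT eqP (canon_idem t)).

Definition ct_leaf : ctree := mkct (RNode [::]).

(* Vertices of a planar rooted tree, addressed by the path of child   *)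
(* indices from the root ([::] is the root).                          *)
Fixpoint vertices (t : rtree) : seq (seq nat) :=
  let: RNode ts := t in
  [::] :: (fix aux (i : nat) (us : seq rtree) :=
             match us with
             | [::] => [::]
             | u :: us' => map (cons i) (vertices u) ++ aux i.+1 us'
             end) 0%N ts.

Definition tweight (t : rtree) : nat := size (vertices t).

Fixpoint subtree (t : rtree) (a : seq nat) {struct a} : rtree :=
  match a with
  | [::] => t
  | i :: a' => let: RNode ts := t in subtree (nth t ts i) a'
  end.

(* remove the subtrees rooted at the (non-root) addresses in [C]      *)
(* (i.e. delete the edges into these vertices and keep the component  *)
(* of the root)                                                       *)
Fixpoint prune (t : rtree) (C : seq (seq nat)) : rtree :=
  let: RNode ts := t in
  RNode ((fix aux (i : nat) (us : seq rtree) :=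
            match us with
            | [::] => [::]
            | u :: us' =>
                (if [:: i] \in C then [::]
                 else [:: prune u [seq behead a | a <- C &
                                    (a != [::]) && (head 0%N a == i)]])
                ++ aux i.+1 us'
            end) 0%N ts).

Fixpoint graft (t : rtree) (a : seq nat) (ms : seq rtree) {struct a} : rtree :=
  match a with
  | [::] => let: RNode ts := t in RNode (ts ++ ms)
  | i :: a' => let: RNode ts := t in
      RNode [seq if j == i then graft u a' ms else u
            | '(j, u) <- zip (iota 0 (size ts)) ts]
  end.

(* The Connes-Kreimer Hopf algebra H_R = Q[rooted trees]:             *)
(* forests are commutative monomials in (isomorphism classes of)      *)
(* rooted trees; H_R is the monoid algebra of forests over Q.         *)
Definition forest := {cmonom ctree}.
Definition HR := {malg rat[forest]}.

Definition forest_of (s : seq rtree) : forest :=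
  \big[mmul/mone]_(x <- s) ucm (mkct x).

Definition trees_of (m : forest) : seq ctree :=
  flatten [seq nseq (m t) t | t <- finsupp m].

Definition fweight (m : forest) : nat :=
  (\sum_(t <- trees_of m) tweight (val t))%N.

(* H_R (x) H_R, realised as the monoid algebra over pairs of forests. *)
Definition fpair : Type := (forest * forest)%type.
HB.instance Definition _ := Choice.on fpair.

Section FPair.
Local Notation "x * y" := (mmul x y) : monom_scope.
Local Open Scope monom_scope.

Definition fpone : fpair := (mone, mone).
Definition fpmul (x y : fpair) : fpair := (x.1 * y.1, x.2 * y.2)%M.

Lemma fpmulA : associative fpmul.
Proof. by move=> x y z; rewrite /fpmul !mulmA. Qed.
Lemma fpmul1m : left_id fpone fpmul.
Proof. by move=> [x1 x2]; rewrite /fpmul /= !mul1m. Qed.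
Lemma fpmulm1 : right_id fpone fpmul.
Proof. by move=> [x1 x2]; rewrite /fpmul /= !mulm1. Qed.
Lemma fpunitm x y : fpmul x y = fpone -> x = fpone /\ y = fpone.
Proof.
case: x y => [x1 x2] [y1 y2] [] /unitm[-> ->] /unitm[-> ->]; by [].
Qed.
End FPair.

HB.instance Definition _ := Choice_isMonomialDef.Build fpair
  fpmulA fpmul1m fpmulm1 fpunitm.

Definition HR2 := {malg rat[fpair]}.

Definition tens (x y : HR) : HR2 :=
  \sum_(m <- msupp x) \sum_(n <- msupp y)
     << x@_m * y@_n *g ((m, n) : fpair) >>.

(* Admissible cuts of a tree [t]: nonempty sets of edges (each edge   *)
(* identified with its target vertex, a non-root vertex) meeting each *)
(* root-to-vertex path at most once.                                  *)
Definition admissible (t : rtree) (C : {set 'I_(size (vertices t))}) : bool :=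
  let v i := nth [::] (vertices t) i in
  [&& C != set0,
      [forall i in C, v i != [::]] &
      [forall i in C, forall j in C, (i != j) ==> ~~ prefix (v i) (v j)]].

Definition cut_addrs (t : rtree) (C : {set 'I_(size (vertices t))}) :=
  map (fun i : 'I_(size (vertices t)) => nth [::] (vertices t) i) (enum C).

Definition cutP (t : rtree) (C : {set 'I_(size (vertices t))}) : forest :=
  forest_of [seq subtree t a | a <- cut_addrs C].

Definition cutR (t : rtree) (C : {set 'I_(size (vertices t))}) : forest :=
  ucm (mkct (prune t (cut_addrs C))).

Definition Delta_tree (t : ctree) : HR2 :=
  tens 1 << ucm t >> + tens << ucm t >> 1 +
  \sum_(C : {set 'I_(size (vertices (val t)))} | admissible C)
     << ((cutP C, cutR C) : fpair) >>.

Definition Delta_forest (m : forest) : HR2 :=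
  \prod_(t <- trees_of m) Delta_tree t.

Definition Delta (x : HR) : HR2 := \sum_(m <- msupp x) x@_m *: Delta_forest m.

Definition Delta_red (x : HR) : HR2 := Delta x - tens 1 x - tens x 1.

Definition primitive (x : HR) : bool := Delta_red x == 0.

Definition ftop (M N : forest) : HR :=
  if N == mone then 0 else
  let ts := trees_of N in
  (fweight N)%:R^-1 *:
  \sum_(j < size ts)
     \sum_(v <- vertices (val (nth ct_leaf ts j)))
        << mmul (\big[mmul/mone]_(k < size ts | k != j) ucm (nth ct_leaf ts k))
                (ucm (mkct (graft (val (nth ct_leaf ts j)) v
                                  [seq val u | u <- trees_of M]))) >>.

Definition top (x y : HR) : HR :=
  \sum_(m <- msupp x) \sum_(n <- msupp y) (x@_m * y@_n) *: ftop m n.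

(* F_i (p_i ⊗ ... ⊗ p_1) = (...(p_i ⊤ p_(i-1)) ...) ⊤ p_1,            *)
(* the argument list being [:: p_i; ...; p_1].                          *)
Definition Fmap (ps : seq HR) : HR :=
  match ps with
  | [::] => 0
  | p :: ps' => foldl top p ps'
  end.

Definition top_pi (pi : HR -> HR) (X : HR2) : HR :=
  \sum_(mn <- msupp X) X@_mn *: top << mn.1 >> (pi << mn.2 >>).

(* Main.v *)
Require Import Defs.
From HB Require Import structures.
From mathcomp Require Import all_boot all_order all_algebra.
From mathcomp Require Import finmap.
From mathcomp Require Import monalg.

Set Implicit Arguments.
Unset Printing Implicit Defensive.

Import GRing.Theory Num.Theory.
Local Open Scope ring_scope.

(** For primitive p and a forest M, cutting a forest in which M has been grafted
    onto p gives
      Delta (M top p) = (M top p) (x) 1 + sum M' (x) (M'' top p),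
    because p has no proper cuts (up to the weight in the denominator of [ftop],
    which is additive along cuts).  By induction on the weight of F, the element
    q = F - sum F' top pi1(F'') is then primitive: by coassociativity its reduced
    coproduct is sum F' (x) (F'' - pi1(F'') - sum F''' top pi1(F'''')), which
    vanishes by the formula for F''.  In F = q + sum F' top pi1(F'') each summand
    F' top pi1(F'') has F' in the span of the Im(F_j), j >= 1, by induction, and
    pi1(F'') primitive, so pi1 kills the sum and fixes q. *)

(** The obstacle is one of representation. Forests are isomorphism classes, but [Delta_tree] and
    [ftop] are given by vertex addresses and sets of edges on chosen representatives, where no
    induction is available. So coassociativity and the rule for cutting a grafted forest are proved
    by structural recursion on planar lists, as identities between sums of functions into any
    commutative monoid. They descend to classes because the sum of a class function over the cuts or
    graftings of a list depends only on the classes involved. The link with the address-based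
    definitions is made separately: vertex addresses give graftings, antichains of addresses give
    cuts. The empty forest needs care, since [ftop] vanishes when its second argument is 1. A
    primitive element has no constant term, so this convention never interferes, and 1 acts as a
    left unit for [top] on primitives. *)

Definition cut : Type := (seq rtree * seq rtree)%type.

Definition cut_cat (a b : cut) : cut := (a.1 ++ b.1, a.2 ++ b.2).

(* Unlike the admissible cuts of [Delta_tree], these include the empty cut and
   the total cut [([:: t], [::])], and they keep the planar order of the trees,
   which makes coassociativity an identity between sums of arbitrary functions. *)
Fixpoint cuts (t : rtree) : seq cut :=
  let: RNode ts := t in
  ([:: t], [::]) ::
  [seq (c.1, [:: RNode c.2]) | c <-
     foldr (fun u r => [seq cut_cat a b | a <- cuts u, b <- r])
           [:: ([::], [::])] ts].

Definition cutsF (s : seq rtree) : seq cut :=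
  foldr (fun u r => [seq cut_cat a b | a <- cuts u, b <- r])
        [:: ([::], [::])] s.

(** One entry per vertex, in the order of [vertices] and with repetitions kept, so that the number
    of entries is the weight used as denominator in [ftop]. *)
Fixpoint grafts (ms : seq rtree) (t : rtree) : seq rtree :=
  let: RNode ts := t in
  RNode (ts ++ ms) ::
  map RNode ((fix aux us := match us with
                | [::] => [::]
                | u :: us' => [seq x :: us' | x <- grafts ms u] ++
                              [seq u :: r | r <- aux us']
                end) ts).

Fixpoint graftsF (ms s : seq rtree) : seq (seq rtree) :=
  if s is u :: s' then
    [seq x :: s' | x <- grafts ms u] ++ [seq u :: r | r <- graftsF ms s']
  else [::].

Lemma cutsE ts :
  cuts (RNode ts) =
    ([:: RNode ts], [::]) :: [seq (c.1, [:: RNode c.2]) | c <- cutsF ts].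
Proof. by []. Qed.

Lemma graftsE ms ts :
  grafts ms (RNode ts) = RNode (ts ++ ms) :: map RNode (graftsF ms ts).
Proof. by congr (_ :: map _ _); elim: ts => //= u us ->. Qed.

Lemma graftsF_cons ms u s :
  graftsF ms (u :: s) =
    [seq x :: s | x <- grafts ms u] ++ [seq u :: r | r <- graftsF ms s].
Proof. by []. Qed.

Arguments cuts : simpl never.
Arguments cutsF : simpl never.
Arguments grafts : simpl never.
Arguments graftsF : simpl never.

(** * Sums over cuts and graftings of planar forests *)

Section PlanarSums.
Variable V : nmodType.
Implicit Types (f : seq rtree -> seq rtree -> V) (g : seq rtree -> V).

Lemma sum_cutsF_nil f : \sum_(c <- cutsF [::]) f c.1 c.2 = f [::] [::].
Proof. by rewrite big_seq1. Qed.

Lemma sum_cutsF_cons f t s :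
  \sum_(c <- cutsF (t :: s)) f c.1 c.2 =
  \sum_(a <- cuts t) \sum_(b <- cutsF s) f (a.1 ++ b.1) (a.2 ++ b.2).
Proof. exact: big_allpairs_dep. Qed.

Lemma sum_cutsF_seq1 f t :
  \sum_(c <- cutsF [:: t]) f c.1 c.2 = \sum_(c <- cuts t) f c.1 c.2.
Proof.
rewrite sum_cutsF_cons; apply: eq_bigr => a _.
by rewrite (sum_cutsF_nil (fun x y => f (a.1 ++ x) (a.2 ++ y))) !cats0.
Qed.

Lemma sum_cuts_node f ts :
  \sum_(c <- cuts (RNode ts)) f c.1 c.2 =
  f [:: RNode ts] [::] + \sum_(c <- cutsF ts) f c.1 [:: RNode c.2].
Proof. by rewrite cutsE big_cons big_map. Qed.

Lemma sum_cutsF_cat f s t :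
  \sum_(c <- cutsF (s ++ t)) f c.1 c.2 =
  \sum_(a <- cutsF s) \sum_(b <- cutsF t) f (a.1 ++ b.1) (a.2 ++ b.2).
Proof.
elim: s f => [|u s IHs] f.
  by rewrite (sum_cutsF_nil (fun x y => \sum_(b <- cutsF t) f (x ++ b.1) (y ++ b.2))).
rewrite sum_cutsF_cons.
rewrite (sum_cutsF_cons (fun x y => \sum_(b <- cutsF t) f (x ++ b.1) (y ++ b.2))).
apply: eq_bigr => a _.
rewrite (IHs (fun x y => f (a.1 ++ x) (a.2 ++ y))).
by apply: eq_bigr => b _; apply: eq_bigr => c _; rewrite !catA.
Qed.

Lemma sum_graftsF_cat g ms s t :
  \sum_(k <- graftsF ms (s ++ t)) g k =
  \sum_(k <- graftsF ms s) g (k ++ t) + \sum_(k <- graftsF ms t) g (s ++ k).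
Proof.
elim: s g => [|u s IHs] g; first by rewrite big_nil add0r.
rewrite cat_cons !graftsF_cons.
rewrite !big_cat !big_map /= -addrA; congr (_ + _).
exact: (IHs (fun x => g (u :: x))).
Qed.

Lemma sum_graftsF_seq1 g ms t :
  \sum_(k <- graftsF ms [:: t]) g k = \sum_(k <- grafts ms t) g [:: k].
Proof. by rewrite graftsF_cons cats0 big_map. Qed.

Lemma sum_grafts_node g ms ts :
  \sum_(k <- grafts ms (RNode ts)) g [:: k] =
  g [:: RNode (ts ++ ms)] + \sum_(k <- graftsF ms ts) g [:: RNode k].
Proof. by rewrite graftsE big_cons big_map. Qed.

(** Trees enter only as one-tree forests, so one predicate on forests replaces a mutual induction.
    The tree case opens a root once and passes to the forest of its children. *)
Lemma rforest_ind (P : seq rtree -> Prop) :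
  P [::] -> (forall ts, P ts -> P [:: RNode ts]) ->
  (forall t s, P [:: t] -> P s -> P (t :: s)) -> forall s, P s.
Proof.
move=> P0 P1 Pc.
have Pt : forall t, P [:: t].
  elim/rtree_ind2 => ts IH; apply: P1.
  elim: ts IH => [//|u ts IHts] IH; apply: Pc; first by apply: IH; rewrite mem_head.
  by apply: IHts => x xts; apply: IH; rewrite in_cons xts orbT.
by elim=> [//|t s IHs]; apply: Pc.
Qed.

(** Both sides run over the ways to split the forest into three layers. The tree case is the cocycle
    identity Delta B+ = B+ (x) 1 + (id (x) B+) Delta; the case of a longer list is
    multiplicativity. *)
Lemma cutsF_coassoc s (f : seq rtree -> seq rtree -> seq rtree -> V) :
  \sum_(c <- cutsF s) \sum_(d <- cutsF c.1) f d.1 d.2 c.2 =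
  \sum_(c <- cutsF s) \sum_(d <- cutsF c.2) f c.1 d.1 d.2.
Proof.
elim/rforest_ind: s f => [|ts IHts|t s IHt IHs] f.
- by rewrite !big_seq1.
- rewrite (sum_cutsF_seq1 (fun x y => \sum_(d <- cutsF x) f d.1 d.2 y)).
  rewrite (sum_cutsF_seq1 (fun x y => \sum_(d <- cutsF y) f x d.1 d.2)).
  rewrite (sum_cuts_node (fun x y => \sum_(d <- cutsF x) f d.1 d.2 y)).
  rewrite (sum_cuts_node (fun x y => \sum_(d <- cutsF y) f x d.1 d.2)).
  rewrite (sum_cutsF_seq1 (fun x y => f x y [::])) (sum_cuts_node (fun x y => f x y [::])).
  rewrite (sum_cutsF_nil (f [:: RNode ts])) -addrA; congr (_ + _).
  rewrite (IHts (fun x y z => f x y [:: RNode z])) -big_split; apply: eq_bigr => c _ /=.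
  by rewrite (sum_cutsF_seq1 (f c.1)) (sum_cuts_node (f c.1)).
- rewrite (sum_cutsF_cat (fun x y => \sum_(d <- cutsF x) f d.1 d.2 y) [:: t]).
  rewrite (sum_cutsF_cat (fun x y => \sum_(d <- cutsF y) f x d.1 d.2) [:: t]).
  under eq_bigr => a _.
    under eq_bigr => b _.
      rewrite (sum_cutsF_cat (fun x y => f x y (a.2 ++ b.2))).
    over.
    rewrite exchange_big.
    under eq_bigr => c _.
      rewrite (IHs (fun x y z => f (c.1 ++ x) (c.2 ++ y) (a.2 ++ z))).
    over.
  over.
  rewrite (IHt (fun x y z => \sum_(i <- cutsF s) \sum_(d <- cutsF i.2)
                               f (x ++ i.1) (y ++ d.1) (z ++ d.2))).
  apply: eq_bigr => a _; rewrite exchange_big; apply: eq_bigr => b _.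
  by rewrite (sum_cutsF_cat (fun x y => f (a.1 ++ b.1) x y)).
Qed.

(** The vertex receiving [ms] lies either in the removed part, which then carries [ms] whole because
    a path is cut at most once, or in the trunk, and then [ms] undergoes a cut [d] of its own. The
    symmetry of [f] is needed because trees cut off [ms] appear in the middle of the removed list
    when [ms] sits on an early tree. *)
Lemma cutsF_graftsF ms s f :
  (forall x x' y, perm_eq x x' -> f x y = f x' y) ->
  \sum_(k <- graftsF ms s) \sum_(c <- cutsF k) f c.1 c.2 =
  \sum_(c <- cutsF s)
    (\sum_(k <- graftsF ms c.1) f k c.2 +
     \sum_(d <- cutsF ms) \sum_(k <- graftsF d.2 c.2) f (c.1 ++ d.1) k).
Proof.
elim/rforest_ind: s f => [|ts IHts|t s IHt IHs] f fP.
- rewrite (sum_cutsF_nil (fun x y => \sum_(k <- graftsF ms x) f k y +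
     \sum_(d <- cutsF ms) \sum_(k <- graftsF d.2 y) f (x ++ d.1) k)).
  by rewrite !big_nil add0r big1 // => d _; rewrite big_nil.
- rewrite (sum_cutsF_seq1 (fun x y => \sum_(k <- graftsF ms x) f k y +
     \sum_(d <- cutsF ms) \sum_(k <- graftsF d.2 y) f (x ++ d.1) k)).
  rewrite (sum_cuts_node (fun x y => \sum_(k <- graftsF ms x) f k y +
     \sum_(d <- cutsF ms) \sum_(k <- graftsF d.2 y) f (x ++ d.1) k)).
  (* The total cut leaves no trunk to graft on. *)
  rewrite [X in _ = _ + X + _]big1 ?addr0; last by move=> d _; rewrite big_nil.
  rewrite (sum_graftsF_seq1 (fun x => \sum_(c <- cutsF x) f c.1 c.2)).
  rewrite (sum_grafts_node (fun x => \sum_(c <- cutsF x) f c.1 c.2)).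
  rewrite (sum_graftsF_seq1 (fun x => f x [::])) (sum_grafts_node (fun x => f x [::])).
  have nodeE us : \sum_(c <- cutsF [:: RNode us]) f c.1 c.2 =
    f [:: RNode us] [::] + \sum_(c <- cutsF us) f c.1 [:: RNode c.2].
    by rewrite sum_cutsF_seq1 sum_cuts_node.
  rewrite nodeE; under [X in _ + X = _]eq_bigr => k _ do rewrite nodeE.
  rewrite big_split /= -!addrA; congr (_ + _).
  rewrite addrCA; congr (_ + _).
  rewrite (IHts (fun x y => f x [:: RNode y])); last by move=> x x' y; apply: fP.
  rewrite (sum_cutsF_cat (fun x y => f x [:: RNode y])) -big_split /=.
  apply: eq_bigr => c _; rewrite addrCA; congr (_ + _).
  rewrite -big_split; apply: eq_bigr => d _ /=.
  by rewrite (sum_graftsF_seq1 (f (c.1 ++ d.1))) (sum_grafts_node (f (c.1 ++ d.1))).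
- rewrite (sum_graftsF_cat (fun x => \sum_(c <- cutsF x) f c.1 c.2) ms [:: t]).
  rewrite (sum_cutsF_cat (fun x y => \sum_(k <- graftsF ms x) f k y +
     \sum_(d <- cutsF ms) \sum_(k <- graftsF d.2 y) f (x ++ d.1) k) [:: t]).
  under eq_bigr => k _ do rewrite sum_cutsF_cat exchange_big.
  rewrite exchange_big /=.
  have fPl b1 b2 x x' y : perm_eq x x' -> f (x ++ b1) (y ++ b2) = f (x' ++ b1) (y ++ b2).
    by move=> xx'; apply: fP; rewrite perm_cat2r.
  have fPr a1 a2 x x' y : perm_eq x x' -> f (a1 ++ x) (a2 ++ y) = f (a1 ++ x') (a2 ++ y).
    by move=> xx'; apply: fP; rewrite perm_cat2l.
  under eq_bigr => b _ do
    rewrite (IHt (fun x y => f (x ++ b.1) (y ++ b.2)) (fPl _ _)).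
  under [X in _ + X = _]eq_bigr => k _ do rewrite (sum_cutsF_cat _ [:: t]).
  rewrite [X in _ + X = _]exchange_big /=.
  under [X in _ + X = _]eq_bigr => a _ do
    rewrite (IHs (fun x y => f (a.1 ++ x) (a.2 ++ y)) (fPr _ _)).
  rewrite exchange_big -big_split; apply: eq_bigr => a _ /=.
  rewrite -big_split; apply: eq_bigr => b _ /=.
  rewrite (sum_graftsF_cat (f^~ (a.2 ++ b.2))) -!addrA; congr (_ + _).
  rewrite addrCA; congr (_ + _); rewrite -big_split; apply: eq_bigr => d _ /=.
  rewrite (sum_graftsF_cat (f ((a.1 ++ b.1) ++ d.1))); congr (_ + _); apply: eq_bigr => k _.
    by apply: fP; rewrite -!catA perm_cat2l perm_catC.
  by rewrite catA.
Qed.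

End PlanarSums.

Arguments sum_cutsF_nil {V}.
Arguments sum_cutsF_cons {V}.
Arguments sum_cutsF_seq1 {V}.
Arguments sum_cuts_node {V}.
Arguments sum_cutsF_cat {V}.
Arguments sum_graftsF_cat {V}.
Arguments sum_graftsF_seq1 {V}.
Arguments sum_grafts_node {V}.
Arguments cutsF_coassoc {V}.
Arguments cutsF_graftsF {V}.

(** * Planar representatives of isomorphism classes, and their weights *)

Lemma forest_of_nil : forest_of [::] = mone.
Proof. exact: big_nil. Qed.

Lemma forest_of_cons t s : forest_of (t :: s) = mmul (ucm (mkct t)) (forest_of s).
Proof. exact: big_cons. Qed.

Lemma forest_of_cat s t : forest_of (s ++ t) = mmul (forest_of s) (forest_of t).
Proof. exact: big_cat. Qed.

Lemma perm_forest_of s t : perm_eq s t -> forest_of s = forest_of t.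
Proof. exact: perm_big. Qed.

Lemma forest_ofE s t : forest_of s t = count_mem t (map mkct s).
Proof.
elim: s => [|u s IHs]; first by rewrite forest_of_nil cm1.
by rewrite forest_of_cons cmM IHs cmU.
Qed.

Lemma count_trees_of (m : forest) t : count_mem t (trees_of m) = m t.
Proof.
rewrite /trees_of count_flatten -map_comp sumnE big_map.
under eq_bigr => u _ do rewrite /= count_nseq /=.
have [tm|] := boolP (t \in finsupp m).
  rewrite (big_rem t) //= eqxx mul1n big1_seq ?addn0 // => u /= ut.
  by case: eqP ut => [->|] //; rewrite mem_rem_uniqF ?fset_uniq.
by rewrite -cmE_eq0 => /eqP mt0; rewrite mt0 big1 // => u _; case: eqP => // ->; rewrite mt0.
Qed.

Lemma trees_of_forest_of s : perm_eq (trees_of (forest_of s)) (map mkct s).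
Proof. by apply/allP => t _ /=; rewrite count_trees_of forest_ofE. Qed.

Definition planar (m : forest) : seq rtree := map val (trees_of m).

Lemma val_mkct t : val (mkct t) = canon t.
Proof. by []. Qed.

Lemma mkct_canon t : mkct (canon t) = mkct t.
Proof. by apply: val_inj; rewrite /= canon_idem. Qed.

Lemma mkct_val (t : ctree) : mkct (val t) = t.
Proof. by apply: val_inj; rewrite val_mkct; exact/eqP/(valP t). Qed.

Lemma planarK : cancel planar forest_of.
Proof.
move=> m; apply/eqP/cmP => t.
rewrite forest_ofE -map_comp -count_trees_of; congr (count _ _).
by apply: map_id_in => u _; apply: mkct_val.
Qed.

Lemma planar_forest_of s : perm_eq (planar (forest_of s)) (map canon s).
Proof.
have -> : map canon s = map val (map mkct s) by rewrite -map_comp.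
exact/perm_map/trees_of_forest_of.
Qed.

Lemma forest_of_canon s : forest_of (map canon s) = forest_of s.
Proof.
apply/eqP/cmP => t; rewrite !forest_ofE -map_comp; congr (count _ _).
by apply: eq_map => u; apply: mkct_canon.
Qed.

Lemma tweight_node ts : tweight (RNode ts) = (\sum_(t <- ts) tweight t).+1.
Proof.
rewrite /tweight /=; congr _.+1; move: {1}0%N.
elim: ts => [|t ts IHts] i; first by rewrite big_nil.
by rewrite size_cat size_map IHts big_cons.
Qed.

Lemma tweight_canon t : tweight (canon t) = tweight t.
Proof.
elim/rtree_ind2: t => ts IH; rewrite !tweight_node; congr _.+1.
rewrite (perm_big (map canon ts)) ?perm_sort //= big_map.
by rewrite big_seq [RHS]big_seq; apply: eq_bigr.
Qed.

Lemma fweight_forest_of s : fweight (forest_of s) = (\sum_(t <- s) tweight t)%N.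
Proof.
rewrite /fweight (perm_big _ (trees_of_forest_of s)) big_map.
by apply: eq_bigr => t _; rewrite val_mkct tweight_canon.
Qed.

Lemma fweight_planar m : (\sum_(t <- planar m) tweight t)%N = fweight m.
Proof. by rewrite big_map. Qed.

Lemma fweight1 : fweight mone = 0%N.
Proof. by rewrite -forest_of_nil fweight_forest_of big_nil. Qed.

Lemma tweight_gt0 t : (0 < tweight t)%N.
Proof. by case: t => ts; rewrite tweight_node. Qed.

Lemma fweight_eq0 m : (fweight m == 0%N) = (m == mone).
Proof.
apply/idP/eqP => [|->]; last by rewrite fweight1.
rewrite -(planarK m); case: (planar m) => [|t s]; first by rewrite forest_of_nil.
by rewrite fweight_forest_of big_cons addn_eq0 eqn0Ngt tweight_gt0.
Qed.

Lemma cutsF_weight s c : c \in cutsF s ->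
  (\sum_(t <- c.1) tweight t + \sum_(t <- c.2) tweight t = \sum_(t <- s) tweight t)%N.
Proof.
elim/rforest_ind: s c => [|ts IHts|t s IHt IHs] c.
- by rewrite inE => /eqP ->; rewrite !big_nil.
- case/allpairsP => -[a b] [/= au bu ->]; move: bu au; rewrite inE => /eqP->; rewrite cutsE inE.
  case/orP => [/eqP->|/mapP[d dts ->]]; rewrite /= ?cats0 !big_seq1 ?big_nil ?addn0 //.
  by rewrite !tweight_node addnS IHts.
- case/allpairsP => -[a b] /= [at_ bs ->] /=; rewrite !big_cat big_cons /=.
  rewrite addnACA (IHs _ bs); congr (_ + _)%N.
  have := IHt a; rewrite !big_seq1; apply.
  by apply/allpairsP; exists (a, ([::], [::])); rewrite /cut_cat /= !cats0 -surjective_pairing.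
Qed.

(** The operator B+, which joins the trees of a forest under a new root. It is defined on classes so
    that composing a class function with it gives a class function again, as the tree cases below
    require. *)
Definition Bplus (m : forest) : forest := ucm (mkct (RNode (planar m))).

Lemma Bplus_forest_of s : Bplus (forest_of s) = forest_of [:: RNode s].
Proof.
rewrite forest_of_cons forest_of_nil mulm1; congr ucm; apply: val_inj => /=; congr RNode.
apply/perm_sortP; [exact: rtree_le_total | exact: rtree_le_trans | |].
  by move=> a b leab; apply: (pcan_inj choice.pickleK); apply/eqP; rewrite eqn_leq.
have -> : map canon s = map canon (map canon s).
  by rewrite -map_comp; apply: eq_map => t /=; rewrite canon_idem.
exact/perm_map/planar_forest_of.
Qed.

(** * Invariance of the planar sums under isomorphism *)

Section IsoInvariance.
Variable V : nmodType.
Implicit Types (f : forest -> forest -> V) (g : forest -> V).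

Lemma perm_sum_cutsF f s t : perm_eq s t ->
  \sum_(c <- cutsF s) f (forest_of c.1) (forest_of c.2) =
  \sum_(c <- cutsF t) f (forest_of c.1) (forest_of c.2).
Proof.
move=> st; pose F x y := f (forest_of x) (forest_of y).
rewrite -/(F _ _).
(* Exchanging adjacent blocks generates all permutations, and the cuts of two blocks are chosen
   independently, so each exchange only swaps two sums. *)
apply: (@catCA_perm_ind _ (fun t => \sum_(c <- cutsF s) F c.1 c.2 =
          \sum_(c <- cutsF t) F c.1 c.2) _ _ _ st erefl) => s1 s2 s3 ->.
rewrite !(sum_cutsF_cat F).
rewrite (eq_bigr _ (fun a _ => sum_cutsF_cat (fun x y => F (a.1 ++ x) (a.2 ++ y)) _ _)).
rewrite [RHS](eq_bigr _ (fun a _ => sum_cutsF_cat (fun x y => F (a.1 ++ x) (a.2 ++ y)) _ _)).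
rewrite exchange_big; do 3!apply: eq_bigr => ? _.
by rewrite /F; congr f; apply: perm_forest_of; rewrite perm_catCA.
Qed.

(** At a node, [canon] sorts the children, which is a permutation, after normalising each of them,
    which is the induction hypothesis applied with [Bplus] on the trunk. *)
Lemma sum_cutsF_canon f s :
  \sum_(c <- cutsF (map canon s)) f (forest_of c.1) (forest_of c.2) =
  \sum_(c <- cutsF s) f (forest_of c.1) (forest_of c.2).
Proof.
elim/rforest_ind: s f => [//|ts IHts|t s IHt IHs] f.
- rewrite /= 2!(sum_cutsF_seq1 (fun x y => f (forest_of x) (forest_of y))).
  rewrite 2!(sum_cuts_node (fun x y => f (forest_of x) (forest_of y))).
  rewrite -(forest_of_canon [:: RNode ts]); congr (_ + _).
  under eq_bigr => c _ do rewrite -Bplus_forest_of.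
  under [RHS]eq_bigr => c _ do rewrite -Bplus_forest_of.
  rewrite (@perm_sum_cutsF (fun x y => f x (Bplus y)) _ (map canon ts)) ?perm_sort //.
  exact: IHts (fun x y => f x (Bplus y)).
- rewrite /= (sum_cutsF_cat (fun x y => f (forest_of x) (forest_of y)) [:: canon t]).
  rewrite (sum_cutsF_cat (fun x y => f (forest_of x) (forest_of y)) [:: t]).
  under eq_bigr => a _ do under eq_bigr => b _ do rewrite !forest_of_cat.
  under [RHS]eq_bigr => a _ do under eq_bigr => b _ do rewrite !forest_of_cat.
  rewrite (IHt (fun x y => \sum_(b <- cutsF (map canon s))
              f (mmul x (forest_of b.1)) (mmul y (forest_of b.2)))).
  apply: eq_bigr => a _.
  exact: IHs (fun x y => f (mmul (forest_of a.1) x) (mmul (forest_of a.2) y)).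
Qed.

Lemma perm_canon s t : forest_of s = forest_of t -> perm_eq (map canon s) (map canon t).
Proof.
by move=> st; apply: perm_trans (planar_forest_of t); rewrite -st perm_sym planar_forest_of.
Qed.

Lemma sum_cutsF_iso f s t : forest_of s = forest_of t ->
  \sum_(c <- cutsF s) f (forest_of c.1) (forest_of c.2) =
  \sum_(c <- cutsF t) f (forest_of c.1) (forest_of c.2).
Proof.
move=> /perm_canon st.
by rewrite -sum_cutsF_canon (perm_sum_cutsF _ _ _ st) sum_cutsF_canon.
Qed.

Lemma sum_graftsF_isol g ms ns s : forest_of ms = forest_of ns ->
  \sum_(k <- graftsF ms s) g (forest_of k) = \sum_(k <- graftsF ns s) g (forest_of k).
Proof.
move=> mns; elim/rforest_ind: s g => [//|ts IHts|t s IHt IHs] g.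
- rewrite !(sum_graftsF_seq1 (g \o forest_of)) !(sum_grafts_node (g \o forest_of)) /=.
  rewrite -!Bplus_forest_of !forest_of_cat mns; congr (_ + _).
  under eq_bigr => k _ do rewrite -Bplus_forest_of.
  under [RHS]eq_bigr => k _ do rewrite -Bplus_forest_of.
  exact: IHts (g \o Bplus).
- rewrite !(sum_graftsF_cat (g \o forest_of) _ [:: t]) /=.
  congr (_ + _).
    under eq_bigr => k _ do rewrite forest_of_cat.
    under [RHS]eq_bigr => k _ do rewrite forest_of_cat.
    exact: IHt (fun x => g (mmul x (forest_of s))).
  under eq_bigr => k _ do rewrite forest_of_cons.
  under [RHS]eq_bigr => k _ do rewrite forest_of_cons.
  exact: IHs (fun x => g (mmul _ x)).
Qed.

Lemma perm_sum_graftsF g ms s t : perm_eq s t ->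
  \sum_(k <- graftsF ms s) g (forest_of k) = \sum_(k <- graftsF ms t) g (forest_of k).
Proof.
move=> st.
apply: (@catCA_perm_ind _ (fun t => \sum_(k <- graftsF ms s) g (forest_of k) =
  \sum_(k <- graftsF ms t) g (forest_of k)) _ _ _ st erefl) => s1 s2 s3 ->.
rewrite !(sum_graftsF_cat (g \o forest_of)).
rewrite (sum_graftsF_cat (g \o forest_of \o cat s1)).
rewrite (sum_graftsF_cat (g \o forest_of \o cat s2)) /= addrCA.
congr (_ + (_ + _)); apply: eq_bigr => k _; congr g; apply: perm_forest_of.
- by rewrite perm_catCA.
- by rewrite perm_catCA.
- by rewrite perm_catCA.
Qed.

Lemma sum_graftsF_canon g ms s :
  \sum_(k <- graftsF ms (map canon s)) g (forest_of k) =
  \sum_(k <- graftsF ms s) g (forest_of k).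
Proof.
elim/rforest_ind: s g => [//|ts IHts|t s IHt IHs] g.
- rewrite /= !(sum_graftsF_seq1 (g \o forest_of)) !(sum_grafts_node (g \o forest_of)) /=.
  have sE : forest_of (sort rtree_le (map canon ts)) = forest_of ts.
    by rewrite -(forest_of_canon ts); apply: perm_forest_of; rewrite perm_sort.
  rewrite -!Bplus_forest_of !forest_of_cat sE; congr (_ + _).
  under eq_bigr => k _ do rewrite -Bplus_forest_of.
  under [RHS]eq_bigr => k _ do rewrite -Bplus_forest_of.
  rewrite (@perm_sum_graftsF (g \o Bplus) _ _ (map canon ts)) ?perm_sort //.
- rewrite /= (sum_graftsF_cat (g \o forest_of) _ [:: canon t]) /=.
  rewrite (sum_graftsF_cat (g \o forest_of) _ [:: t]) /=.
  congr (_ + _).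
    under eq_bigr => k _ do rewrite forest_of_cat forest_of_canon.
    under [RHS]eq_bigr => k _ do rewrite forest_of_cat.
    exact: IHt (fun x => g (mmul x (forest_of s))).
  under eq_bigr => k _ do rewrite forest_of_cons mkct_canon.
  under [RHS]eq_bigr => k _ do rewrite forest_of_cons.
  exact: IHs (fun x => g (mmul _ x)).
Qed.

Lemma sum_graftsF_iso g ms ns s t :
    forest_of ms = forest_of ns -> forest_of s = forest_of t ->
  \sum_(k <- graftsF ms s) g (forest_of k) = \sum_(k <- graftsF ns t) g (forest_of k).
Proof.
move=> mns /perm_canon st; rewrite (sum_graftsF_isol _ _ mns).
by rewrite -sum_graftsF_canon (perm_sum_graftsF _ _ _ _ st) sum_graftsF_canon.
Qed.

End IsoInvariance.

Arguments sum_cutsF_iso {V}.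
Arguments sum_graftsF_iso {V}.

(** * Cuts and graftings of isomorphism classes of forests *)

Definition fcuts (m : forest) : seq fpair :=
  [seq (forest_of c.1, forest_of c.2) | c <- cutsF (planar m)].

Definition fgrafts (m n : forest) : seq forest :=
  map forest_of (graftsF (planar m) (planar n)).

Lemma fcuts_weight m c : c \in fcuts m -> (fweight c.1 + fweight c.2)%N = fweight m.
Proof.
case/mapP => d /cutsF_weight dm ->.
by rewrite !fweight_forest_of dm fweight_planar.
Qed.

Lemma fgrafts_one m : fgrafts m mone = [::].
Proof.
by rewrite /fgrafts -forest_of_nil; have /perm_nilP -> := planar_forest_of [::].
Qed.

Section ForestSums.
Variable V : nmodType.
Implicit Types (f : forest -> forest -> V) (g : forest -> V).

Lemma sum_fcuts f s :
  \sum_(c <- fcuts (forest_of s)) f c.1 c.2 =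
  \sum_(c <- cutsF s) f (forest_of c.1) (forest_of c.2).
Proof. by rewrite big_map; apply: sum_cutsF_iso; rewrite planarK. Qed.

Lemma sum_fgrafts g ms s :
  \sum_(k <- fgrafts (forest_of ms) (forest_of s)) g k =
  \sum_(k <- graftsF ms s) g (forest_of k).
Proof. by rewrite big_map; apply: sum_graftsF_iso; rewrite planarK. Qed.

Lemma fcuts_coassoc m (f : forest -> forest -> forest -> V) :
  \sum_(c <- fcuts m) \sum_(d <- fcuts c.1) f d.1 d.2 c.2 =
  \sum_(c <- fcuts m) \sum_(d <- fcuts c.2) f c.1 d.1 d.2.
Proof.
rewrite !big_map; pose F x y z := f (forest_of x) (forest_of y) (forest_of z).
under eq_bigr => c _ do rewrite (sum_fcuts (fun x y => f x y _)).
under [RHS]eq_bigr => c _ do rewrite (sum_fcuts (fun x y => f _ x y)).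
exact: cutsF_coassoc _ F.
Qed.

Lemma fcuts_fgrafts m n f :
  \sum_(k <- fgrafts m n) \sum_(c <- fcuts k) f c.1 c.2 =
  \sum_(c <- fcuts n)
    (\sum_(k <- fgrafts m c.1) f k c.2 +
     \sum_(d <- fcuts m) \sum_(k <- fgrafts d.2 c.2) f (mmul c.1 d.1) k).
Proof.
pose F x y := f (forest_of x) (forest_of y).
rewrite !big_map; under eq_bigr => k _ do rewrite (sum_fcuts f).
rewrite (cutsF_graftsF _ _ F); last by move=> x x' y /perm_forest_of xx'; rewrite /F xx'.
apply: eq_bigr => c _; congr (_ + _).
  rewrite -{2}(planarK m) (sum_fgrafts (fun k => f k _)) //.
rewrite big_map; apply: eq_bigr => d _ /=.
rewrite (sum_fgrafts (fun k => f _ k)).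
by apply: eq_bigr => k _; rewrite /F forest_of_cat.
Qed.

Lemma forest_of_eq1 s : (forest_of s == mone) = nilp s.
Proof.
rewrite -fweight_eq0 fweight_forest_of; case: s => [|t s]; first by rewrite big_nil.
by rewrite big_cons addn_eq0 eqn0Ngt tweight_gt0.
Qed.

Lemma sum_cutsF_top (h : seq rtree -> seq rtree -> V) s :
  \sum_(c <- cutsF s | nilp c.2) h c.1 c.2 = h s [::].
Proof.
rewrite big_mkcond; elim/rforest_ind: s h => [|ts IHts|t s IHt IHs] h.
- by rewrite big_seq1.
- rewrite (sum_cutsF_seq1 (fun x y => if nilp y then h x y else 0)).
  rewrite (sum_cuts_node (fun x y => if nilp y then h x y else 0)) /=.
  by rewrite big1 ?addr0.
- rewrite (sum_cutsF_cat (fun x y => if nilp y then h x y else 0) [:: t]).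
  rewrite -(IHt (fun x y => h (x ++ s) y)); apply: eq_bigr => a _ /=.
  case: nilP => [a2|a2]; last by rewrite big1 // => b _; rewrite cat_nilp; case: nilP a2.
  by rewrite a2 /= (IHs (fun x y => h (a.1 ++ x) y)).
Qed.

Lemma sum_cutsF_bot (h : seq rtree -> seq rtree -> V) s :
  \sum_(c <- cutsF s | nilp c.1) h c.1 c.2 = h [::] s.
Proof.
rewrite big_mkcond; elim/rforest_ind: s h => [|ts IHts|t s IHt IHs] h.
- by rewrite big_seq1.
- rewrite (sum_cutsF_seq1 (fun x y => if nilp x then h x y else 0)).
  rewrite (sum_cuts_node (fun x y => if nilp x then h x y else 0)) /= add0r.
  exact: IHts (fun x y => h x [:: RNode y]).
- rewrite (sum_cutsF_cat (fun x y => if nilp x then h x y else 0) [:: t]).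
  rewrite -(IHt (fun x y => h x (y ++ s))); apply: eq_bigr => a _ /=.
  case: nilP => [a1|a1]; last by rewrite big1 // => b _; rewrite cat_nilp; case: nilP a1.
  by rewrite a1 /= (IHs (fun x y => h x (a.2 ++ y))).
Qed.

Definition proper_cut (c : fpair) := (c.1 != mone) && (c.2 != mone).

Lemma sum_fcuts_top m f : \sum_(c <- fcuts m | c.2 == mone) f c.1 c.2 = f m mone.
Proof.
rewrite big_map; under eq_bigl => c do rewrite forest_of_eq1.
by rewrite (sum_cutsF_top (fun x y => f (forest_of x) (forest_of y))) planarK forest_of_nil.
Qed.

Lemma sum_fcuts_bot m f : \sum_(c <- fcuts m | c.1 == mone) f c.1 c.2 = f mone m.
Proof.
rewrite big_map; under eq_bigl => c do rewrite forest_of_eq1.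
by rewrite (sum_cutsF_bot (fun x y => f (forest_of x) (forest_of y))) planarK forest_of_nil.
Qed.

Lemma sum_fcuts_proper m f : m != mone ->
  \sum_(c <- fcuts m) f c.1 c.2 =
  f m mone + f mone m + \sum_(c <- fcuts m | proper_cut c) f c.1 c.2.
Proof.
move=> m1; rewrite (bigID (fun c => c.2 == mone)) sum_fcuts_top -addrA; congr (_ + _).
rewrite (bigID (fun c => c.1 == mone)) -(sum_fcuts_bot m) /=; congr (_ + _); last first.
  by apply: eq_bigl => c; rewrite /proper_cut andbC.
(* The total and the empty cut are distinct: a cut with both halves empty would force [m] to have
   weight zero. *)
rewrite big_seq_cond [RHS]big_seq_cond; apply: eq_bigl => c.
have [/fcuts_weight cm|//] := boolP (c \in fcuts m).
have [c1|] := eqVneq c.1 mone; last by rewrite andbF.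
rewrite andbT; apply/eqP => c2; case/eqP: m1; apply/eqP.
by rewrite -fweight_eq0 -cm c1 c2 fweight1.
Qed.

(** Both sides equal the sum of [F], the restriction of [f] to triples of nonempty forests, over all
    pairs of successive cuts. An improper outer cut contributes nothing to that sum: additivity of
    the weight makes some entry of the triple empty. *)
Lemma fcuts_coassoc_proper m (f : forest -> forest -> forest -> V) :
  \sum_(c <- fcuts m | proper_cut c)
    \sum_(d <- fcuts c.1 | proper_cut d) f d.1 d.2 c.2 =
  \sum_(c <- fcuts m | proper_cut c)
    \sum_(d <- fcuts c.2 | proper_cut d) f c.1 d.1 d.2.
Proof.
have w1 (a b : forest) : (a == mone) && (b == mone) = (fweight a + fweight b == 0)%N.
  by rewrite addn_eq0 !fweight_eq0.
pose F x y z := if [&& x != mone, y != mone & z != mone] then f x y z else 0.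
transitivity (\sum_(c <- fcuts m) \sum_(d <- fcuts c.1) F d.1 d.2 c.2).
  rewrite big_mkcond; apply: eq_bigr => c _; rewrite big_mkcond /=.
  case: ifP => [/andP[_ c2]|cF].
    by apply: eq_bigr => d _; rewrite /F c2 andbT.
  rewrite big1_seq // => d /= /fcuts_weight dc; rewrite /F; case: ifP => // /and3P[d1 _ c2].
  move: cF; rewrite /proper_cut c2 andbT => /negbFE; rewrite -fweight_eq0 -dc.
  by rewrite -w1 (negbTE d1).
rewrite fcuts_coassoc big_mkcond [RHS]big_mkcond; apply: eq_bigr => c _.
rewrite [in RHS]big_mkcond /=.
case: ifP => [/andP[c1 _]|cF].
  by apply: eq_bigr => d _; rewrite /F c1.
rewrite big1_seq // => d /= /fcuts_weight dc; rewrite /F; case: ifP => // /and3P[c1 d1 _].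
move: cF; rewrite /proper_cut c1 /= => /negbFE; rewrite -fweight_eq0 -dc.
by rewrite -w1 (negbTE d1).
Qed.

End ForestSums.

Arguments sum_fcuts {V}.
Arguments sum_fgrafts {V}.
Arguments fcuts_coassoc {V}.
Arguments fcuts_fgrafts {V}.
Arguments sum_fcuts_proper {V}.
Arguments fcuts_coassoc_proper {V}.

(** * Grafting at an address and the product of two forests *)

Fixpoint verticesF (i : nat) (ts : seq rtree) : seq (seq nat) :=
  if ts is t :: ts' then map (cons i) (vertices t) ++ verticesF i.+1 ts' else [::].

Lemma verticesE ts : vertices (RNode ts) = [::] :: verticesF 0 ts.
Proof. by rewrite /=; congr cons; elim: ts 0%N => //= t ts IHts i; rewrite IHts. Qed.

Arguments vertices : simpl never.

Lemma graft_root ts ms : graft (RNode ts) [::] ms = RNode (ts ++ ms).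
Proof. by []. Qed.

Lemma map_zip_iota_id m n (F : rtree -> rtree) s : (n < m)%N || (m + size s <= n)%N ->
  [seq (let '(j, u) := ju in if j == n then F u else u) | ju <- zip (iota m (size s)) s] = s.
Proof.
elim: s m => //= u s IHs m mn; rewrite IHs; last first.
  by case/orP: mn => mn; rewrite ?addSnnS ?mn ?orbT // ltnS (ltnW mn).
by case: eqP mn => // ->; rewrite ltnn /= addnS ltnNge leq_addr.
Qed.

Lemma graft_child pre t ts a ms :
  graft (RNode (pre ++ t :: ts)) (size pre :: a) ms =
  RNode (pre ++ graft t a ms :: ts).
Proof.
rewrite /= size_cat iotaD zip_cat ?size_iota // map_cat add0n.
rewrite map_zip_iota_id ?leqnn ?orbT //= eqxx.
by rewrite (map_zip_iota_id (size pre).+1) ?leqnn.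
Qed.

Lemma graft_vertices ms t : map (fun a => graft t a ms) (vertices t) = grafts ms t.
Proof.
elim/rtree_ind2: t => ts IH; rewrite verticesE graftsE map_cons graft_root; congr cons.
(* Addresses count children from the start of the list, so the induction on the remaining children
   carries the prefix [pre] already passed. *)
suff H pre us : {subset us <= ts} ->
    map (fun a => graft (RNode (pre ++ us)) a ms) (verticesF (size pre) us) =
    map (fun r => RNode (pre ++ r)) (graftsF ms us).
  exact: (H [::] ts).
elim: us pre => [//|u us IHus] pre us_ts.
rewrite [verticesF _ _]/= graftsF_cons !map_cat; congr cat.
  rewrite -(IH u) ?us_ts ?mem_head // -!map_comp.
  by apply: eq_map => a; apply: graft_child.
rewrite -map_comp -cat_rcons -(size_rcons pre u) IHus; last first.
  by move=> x xus; apply: us_ts; rewrite in_cons xus orbT.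
by apply: eq_map => r; rewrite /= cat_rcons.
Qed.

Lemma sum_graftsF_nth (V : nmodType) (g : forest -> V) ms d s :
  \sum_(k <- graftsF ms s) g (forest_of k) =
  \sum_(j < size s) \sum_(t <- grafts ms (nth d s j))
    g (mmul (\big[mmul/mone]_(k < size s | k != j) ucm (mkct (nth d s k)))
            (ucm (mkct t))).
Proof.
elim: s g => [|u s IHs] g; first by rewrite big_ord0 big_nil.
rewrite graftsF_cons big_cat !big_map big_ord_recl /=; congr (_ + _).
  apply: eq_bigr => t _; rewrite forest_of_cons mulmC; congr (g (mmul _ _)).
  rewrite big_mkcond big_ord_recl /= mul1m -(big_mkord xpredT (fun k => ucm (mkct (nth d s k)))).
  by rewrite /forest_of (big_nth d).
under eq_bigr => k _ do rewrite forest_of_cons.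
rewrite (IHs (fun x => g (mmul (ucm (mkct u)) x))); apply: eq_bigr => j _.
apply: eq_bigr => t _; rewrite mulmA; congr (g (mmul _ _)).
rewrite [RHS]big_mkcond big_ord_recl /=; congr mmul; rewrite big_mkcond.
by apply: eq_bigr => k _; rewrite (inj_eq lift_inj).
Qed.

(** No case distinction remains: the empty forest has no vertex, so its list of graftings is empty
    and the sum vanishes by itself. *)
Lemma ftopE m n : ftop m n = (fweight n)%:R^-1 *: \sum_(k <- fgrafts m n) << k >>.
Proof.
rewrite /ftop; case: eqP => [->|_]; first by rewrite fgrafts_one big_nil scaler0.
congr (_ *: _); rewrite big_map (@sum_graftsF_nth _ (fun k => << k >>) _ (val ct_leaf)) size_map.
apply: eq_bigr => j _; rewrite (nth_map ct_leaf) // -graft_vertices big_map.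
have nthE (k : 'I_(size (trees_of n))) :
  mkct (nth (val ct_leaf) (planar n) k) = nth ct_leaf (trees_of n) k.
  by rewrite (nth_map ct_leaf) // mkct_val.
by apply: eq_bigr => a _; under [in RHS]eq_bigr => k _ do rewrite nthE.
Qed.

(** * Recursive cuts as antichains of vertex addresses *)

Section Antichains.
Implicit Types (i j : nat) (l a b : seq (seq nat)).

(* Antichains of vertex addresses, in the order in which [cuts] lists the
   corresponding cuts; [:: [::]] (the root alone) is the total cut. *)
Fixpoint antis (t : rtree) : seq (seq (seq nat)) :=
  let: RNode ts := t in
  [:: [::]] ::
  (fix aux i us := match us with
     | [::] => [:: [::]]
     | u :: us' => [seq map (cons i) a ++ b | a <- antis u, b <- aux i.+1 us']
     end) 0%N ts.

Fixpoint antisF i (ts : seq rtree) : seq (seq (seq nat)) :=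
  if ts is t :: ts' then [seq map (cons i) a ++ b | a <- antis t, b <- antisF i.+1 ts']
  else [:: [::]].

Lemma antisE ts : antis (RNode ts) = [:: [::]] :: antisF 0 ts.
Proof. by rewrite /=; congr cons; elim: ts 0%N => //= t ts IHts i; rewrite IHts. Qed.

Fixpoint pruneF i (us : seq rtree) l : seq rtree :=
  if us is u :: us' then
    (if [:: i] \in l then [::]
     else [:: prune u [seq behead x | x <- l & (x != [::]) && (head 0%N x == i)]])
    ++ pruneF i.+1 us' l
  else [::].

Lemma pruneE ts l : prune (RNode ts) l = RNode (pruneF 0 ts l).
Proof. by rewrite /=; congr RNode; move: {-1}0%N; elim: ts => //= t ts IHts i; rewrite IHts. Qed.

(** The invariant that separates the addresses in one child from those in its later siblings. The
    root address fails it for every [i]. *)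
Definition above i (x : seq nat) := if x is j :: _ then (i <= j)%N else false.

Lemma aboveS i x : above i.+1 x -> above i x.
Proof. by case: x => //= j _; apply: ltnW. Qed.

Lemma above_root i l : all (above i) l -> [::] \notin l.
Proof. by move=> /allP la; apply/negP => /la. Qed.

Lemma verticesF_above i us : all (above i) (verticesF i us).
Proof.
elim: us i => //= u us IHus i; rewrite all_cat; apply/andP; split.
  by apply/allP => _ /mapP[x _ ->] /=.
by apply: sub_all (IHus i.+1); apply: aboveS.
Qed.

Lemma antisF_above i us l : l \in antisF i us -> all (above i) l.
Proof.
elim: us i l => [|u us IHus] i l /=; first by rewrite inE => /eqP ->.
case/allpairsP => -[a b] [/= _ bus ->]; rewrite all_cat; apply/andP; split.
  by apply/allP => _ /mapP[x _ ->] /=.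
by apply: sub_all (IHus _ _ bus); apply: aboveS.
Qed.

Lemma mem_child i a b x : all (above i.+1) b ->
  (i :: x \in map (cons i) a ++ b) = (x \in a).
Proof.
move=> /allP ba; rewrite mem_cat mem_map; last by move=> y z [].
by rewrite orbC; case: (boolP (i :: x \in b)) => //= /ba /=; rewrite ltnn.
Qed.

Lemma filter_child i a b : all (above i.+1) b ->
  [seq behead x | x <- map (cons i) a ++ b & (x != [::]) && (head 0%N x == i)] = a.
Proof.
move=> ba; rewrite filter_cat map_cat filter_map.
rewrite (eq_filter (a2 := xpredT)) => [|x /=]; last by rewrite eqxx.
rewrite filter_predT -map_comp map_id_in //.
rewrite (eq_in_filter (a2 := pred0)) ?filter_pred0 ?cats0 // => -[|j x] //= /(allP ba) /=.
by rewrite ltn_neqAle eq_sym => /andP[/negbTE].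
Qed.

Lemma pruneF_above i j us a b : (i < j)%N ->
  pruneF j us (map (cons i) a ++ b) = pruneF j us b.
Proof.
elim: us j => //= u us IHus j ij; rewrite IHus ?(ltnW ij) // ?ltnS ?(ltnW ij) //.
congr (_ ++ _); rewrite mem_cat filter_cat filter_map.
have -> : ([:: j] \in map (cons i) a) = false.
  by apply/negP => /mapP[x _ [ji]]; rewrite ji ltnn in ij.
rewrite (eq_filter (a2 := pred0)) ?filter_pred0 // => x /=.
by apply: ltn_eqF.
Qed.

(** Away from the root, [subtree] and [prune] act child by child, as [cuts] does. Since [prune]
    never deletes the root, the total cut has to be given its empty trunk explicitly. *)
Lemma antis_cuts t :
  [seq (map (subtree t) l, if [::] \in l then [::] else [:: prune t l]) | l <- antis t]
  = cuts t.
Proof.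
elim/rtree_ind2: t => ts IH; rewrite antisE cutsE map_cons; congr cons.
suff H pre us : {subset us <= ts} ->
    [seq (map (subtree (RNode (pre ++ us))) l, pruneF (size pre) us l)
       | l <- antisF (size pre) us] = cutsF us.
  rewrite -(H [::] ts) // -map_comp; apply/eq_in_map => l lts /=.
  by rewrite (negbTE (above_root _ _ (antisF_above _ _ _ lts))) -pruneE.
elim: us pre => [//|u us IHus] pre us_ts; rewrite [antisF _ _]/= map_allpairs.
rewrite /cutsF /= -/(cutsF us) -(IH u) ?us_ts ?mem_head //.
rewrite -(IHus (rcons pre u)); last by move=> x xus; apply: us_ts; rewrite in_cons xus orbT.
rewrite allpairs_mapl allpairs_mapr size_rcons cat_rcons; apply/eq_in_allpairs => a b aA bA.
have ba := antisF_above _ _ _ bA.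
rewrite /cut_cat /= map_cat -map_comp mem_child // filter_child // pruneF_above //.
congr (_ ++ _, _); apply: eq_map => x /=.
by rewrite nth_cat ltnn subnn.
Qed.

(** The disjunct [x == y] absorbs the diagonal pairs of [all2rel]; on distinct vertices this is the
    condition in [admissible]. *)
Definition antichain l := all2rel (fun x y => (x == y) || ~~ prefix x y) l.

Lemma antis_uniq t : uniq (antis t).
Proof.
elim/rtree_ind2: t => ts IH; rewrite antisE cons_uniq.
have -> : [:: [::]] \notin antisF 0 ts.
  by apply/negP => /antisF_above /above_root; rewrite inE.
move: 0%N; elim: ts IH => //= u us IHus IH i.
apply: allpairs_uniq => [||[a b] [c d]].
- by apply: IH; rewrite mem_head.
- by apply: IHus => x xus; apply: IH; rewrite in_cons xus orbT.
case/allpairsP => -[a' b'] [/= _ /antisF_above ba [-> ->]] {a b}.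
case/allpairsP => -[c' d'] [/= _ /antisF_above da [-> ->]] {c d} E.
(* The addresses that begin with [i] recover the first part from the concatenation. *)
have ac : a' = c' by rewrite -(filter_child _ a' _ ba) E filter_child.
congr pair => //; move/eqP: E; rewrite ac eqseq_cat // => /andP[_ /eqP].
by [].
Qed.

Lemma subseq_catP (T : eqType) (s s1 s2 : seq T) : subseq s (s1 ++ s2) ->
  exists2 p : seq T * seq T, s = p.1 ++ p.2 & subseq p.1 s1 && subseq p.2 s2.
Proof.
case/subseqP => m; rewrite size_cat => sm ->.
exists (mask (take (size s1) m) s1, mask (drop (size s1) m) s2); last by rewrite !mask_subseq.
by rewrite -[in LHS](cat_take_drop (size s1) m) mask_cat // size_takel // sm leq_addr.
Qed.

Lemma antichain_map i a : antichain (map (cons i) a) = antichain a.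
Proof.
rewrite /antichain allrel_mapl allrel_mapr; apply: eq_allrel => x y /=.
by rewrite eqseq_cons eqxx.
Qed.

Lemma antichain_cat i a b : all (above i.+1) b ->
  antichain (map (cons i) a ++ b) = antichain a && antichain b.
Proof.
move=> ba; rewrite -(antichain_map i a) /antichain allrel_catl !allrel_catr.
have -> : allrel (fun x y => (x == y) || ~~ prefix x y) (map (cons i) a) b.
  apply/allrelP => _ [|j y] /mapP[x _ ->] //= /(allP ba) /= ij.
  by rewrite (ltn_eqF ij) orbT.
have -> : allrel (fun x y => (x == y) || ~~ prefix x y) b (map (cons i) a).
  apply/allrelP => -[|j y] _ /(allP ba) //= ij /mapP[x _ ->] /=.
  by rewrite (gtn_eqF ij) orbT.
by rewrite andbT.
Qed.

(** Together with [antis_uniq], this describes the list without reference to the recursion, in terms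
    that can be compared with subsets of the vertices. *)
Lemma mem_antis t l : (l \in antis t) = subseq l (vertices t) && antichain l.
Proof.
elim/rtree_ind2: t l => ts IH l.
have H i us l' : {subset us <= ts} ->
    (l' \in antisF i us) = subseq l' (verticesF i us) && antichain l'.
  elim: us i l' => [|u us IHus] i l' us_ts; first by rewrite inE subseq0; case: eqP => // ->.
  have us_ts' : {subset us <= ts} by move=> x xus; apply: us_ts; rewrite in_cons xus orbT.
  apply/allpairsP/andP => [[[a b] [/= aA bB ->]]|[/subseq_catP[[x y] /= -> /andP[sx sy]]]].
    have ba := antisF_above _ _ _ bB; move: aA bB; rewrite IH ?us_ts ?mem_head // IHus //.
    move=> /andP[sa aa] /andP[sb ab]; rewrite cat_subseq ?map_subseq // antichain_cat //.
    by rewrite aa ab.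
  have ya : all (above i.+1) y.
    by apply/allP => z /(mem_subseq sy); apply: (allP (verticesF_above _ _)).
  case/subseqP: sx => m; rewrite size_map => sm; rewrite -map_mask => ->.
  rewrite antichain_cat // => /andP[ax ay]; exists (mask m (vertices u), y); split => //=.
    by rewrite IH ?us_ts ?mem_head // mask_subseq.
  by rewrite IHus // sy.
rewrite antisE verticesE inE H //.
have rootV : [::] \notin verticesF 0 ts := above_root _ _ (verticesF_above 0 ts).
case: l => [|x l]; first by rewrite !sub0seq.
rewrite [subseq _ (_ :: _)]/=.
have [->|x0] := eqVneq x [::]; last by rewrite eqseq_cons (negbTE x0).
have -> : subseq ([::] :: l) (verticesF 0 ts) = false.
  by apply: contraNF rootV => /mem_subseq; apply; rewrite mem_head.
case: l => [|y l]; first by rewrite sub0seq.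
(* The root is a prefix of every address, so an antichain of distinct vertices containing it has no
   other element. *)
apply/esym/negbTE/negP => /andP[/mem_subseq yV /allrelP al].
have := al [::] y (mem_head _ _); rewrite !inE eqxx orbT => /(_ isT).
rewrite prefix0s orbF => /eqP y0; move/negP: rootV; apply; apply: yV.
by rewrite -y0 mem_head.
Qed.

Lemma vertices_uniq t : uniq (vertices t).
Proof.
elim/rtree_ind2: t => ts IH; rewrite verticesE cons_uniq (above_root _ _ (verticesF_above _ _)).
move: 0%N; elim: ts IH => //= u us IHus IH i.
rewrite cat_uniq map_inj_uniq => [|x y [] //]; rewrite IH ?mem_head //.
rewrite IHus ?andbT; last by move=> x xus; apply: IH; rewrite in_cons xus orbT.
apply/hasPn => -[|j x] /(allP (verticesF_above _ _)) //= ij.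
by apply/negP => /mapP[y _ [ji]]; rewrite ji ltnn in ij.
Qed.

End Antichains.

(** * Admissible edge sets and antichains *)

Section CutSets.
Variable t : rtree.
Implicit Types C D : {set 'I_(size (vertices t))}.

Lemma cut_addrs_filter C :
  cut_addrs C = 
    [seq nth [::] (vertices t) (i : 'I_(size (vertices t)))
       | i : 'I_(size (vertices t)) <- enum 'I_(size (vertices t)) & i \in C].
Proof. by rewrite /cut_addrs; congr map; rewrite {1}/enum_mem -enumT. Qed.

Lemma map_nth_enum :
  [seq nth [::] (vertices t) (i : 'I_(size (vertices t))) | i <- enum 'I_(size (vertices t))] =
  vertices t.
Proof.
by rewrite -[RHS](mkseq_nth [::]) /mkseq -val_enum_ord -map_comp.
Qed.

Lemma nth_vertices_inj : injective (fun i : 'I_(size (vertices t)) => nth [::] (vertices t) i).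
Proof. by move=> i j /eqP; rewrite nth_uniq ?vertices_uniq // => /eqP/val_inj. Qed.

Lemma mem_cut_addrs C (i : 'I_(size (vertices t))) :
  (nth [::] (vertices t) i \in cut_addrs C) = (i \in C).
Proof. by rewrite /cut_addrs (mem_map nth_vertices_inj) mem_enum. Qed.

Lemma cut_addrs_inj : injective (@cut_addrs t).
Proof. by move=> C D CD; apply/setP => i; rewrite -!mem_cut_addrs CD. Qed.

Lemma cut_addrs_subseq C : subseq (cut_addrs C) (vertices t).
Proof. by rewrite cut_addrs_filter -[X in subseq _ X]map_nth_enum map_subseq ?filter_subseq. Qed.

Lemma subseq_cut_addrs l : subseq l (vertices t) -> exists C, cut_addrs C = l.
Proof.
move=> lt; exists [set i : 'I_(size (vertices t)) | nth [::] (vertices t) i \in l].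
rewrite cut_addrs_filter; under eq_filter => i do rewrite inE.
rewrite -(filter_map (fun i : 'I_(size (vertices t)) => nth [::] (vertices t) i) (mem l)).
by rewrite map_nth_enum; apply/esym/subseq_uniqP; rewrite ?vertices_uniq.
Qed.

Lemma admissibleE C : admissible C =
  [&& cut_addrs C != [::], [::] \notin cut_addrs C & antichain (cut_addrs C)].
Proof.
congr [&& _, _ & _].
- apply/idP/idP; apply: contraNN => /eqP; last by move->; rewrite /cut_addrs enum_set0.
  by move=> C0; apply/eqP/setP => i; rewrite -mem_cut_addrs C0 in_set0 in_nil.
- apply/forall_inP/negP => [Cr /mapP[i]|Cr i iC].
    by rewrite mem_enum => /Cr /eqP i0 /esym /i0.
  by apply/eqP => i0; apply: Cr; rewrite -i0 mem_cut_addrs.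
- apply/forall_inP/allrelP => [Ca _ _ /mapP[i iC ->] /mapP[j jC ->]|Ca i iC].
    rewrite !mem_enum in iC jC; have /forall_inP/(_ j jC) := Ca i iC.
    by rewrite (inj_eq nth_vertices_inj); case: eqP.
  apply/forall_inP => j jC; apply/implyP => ij.
  have := Ca _ _ (etrans (mem_cut_addrs C i) iC) (etrans (mem_cut_addrs C j) jC).
  by rewrite (inj_eq nth_vertices_inj) (negbTE ij).
Qed.

(** Subsets of the vertices correspond to sublists of the duplicate-free list [vertices t], so both
    lists enumerate the same antichains once each. The filter discards the empty cut and the total
    cut. *)
Lemma admissible_antis :
  perm_eq [seq cut_addrs C | C : {set 'I_(size (vertices t))} in @admissible t]
          [seq l <- antis t | (l != [::]) && ([::] \notin l)].
Proof.
apply: uniq_perm => [||l].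
- by rewrite map_inj_uniq ?enum_uniq //; apply: cut_addrs_inj.
- by rewrite filter_uniq ?antis_uniq.
rewrite mem_filter mem_antis; apply/imageP/idP => [[C aC ->]|].
  by have := aC : admissible C; rewrite admissibleE cut_addrs_subseq => /and3P[-> -> ->].
case/and3P => /andP[l0 lr] /subseq_cut_addrs[C Cl] al.
have aC : admissible C by rewrite admissibleE Cl l0 lr.
by exists C.
Qed.

End CutSets.

Lemma sum_admissible t :
  \sum_(C : {set 'I_(size (vertices t))} | admissible C) << ((cutP C, cutR C) : fpair) >> =
  \sum_(c <- cuts t | ~~ nilp c.1 && ~~ nilp c.2)
     << ((forest_of c.1, forest_of c.2) : fpair) >> :> HR2.
Proof.
pose g l : HR2 := << ((forest_of (map (subtree t) l), ucm (mkct (prune t l))) : fpair) >>.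
transitivity
  (\sum_(l <- [seq cut_addrs C | C : {set 'I_(size (vertices t))} in @admissible t]) g l).
  by rewrite big_map big_enum.
rewrite (perm_big _ (admissible_antis t)) /= big_filter -antis_cuts big_map.
apply: eq_big => [l|l /andP[_ /negbTE lr]] /=.
  by rewrite /nilp size_map -!/(nilp _); case: l => //= x l; case: ifP.
by rewrite lr forest_of_cons forest_of_nil mulm1.
Qed.

(** * Linear extension from the basis of monomials *)

Section LinearExtension.
Variables (K : choiceType) (V : lmodType rat).

(** [Delta] and [top_pi] are instances, and [tens] and [top] are nested ones, which yields their
    linearity uniformly. *)
Definition linext (h : K -> V) (x : {malg rat[K]}) : V :=
  \sum_(k <- msupp x) x@_k *: h k.

Lemma linextEw h (d : {fset K}) x : (msupp x `<=` d)%fset ->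
  linext h x = \sum_(k <- d) x@_k *: h k.
Proof.
move=> xd; rewrite /linext (big_fset_incl _ xd) // => k _ /mcoeff_outdom ->.
by rewrite scale0r.
Qed.

Lemma linextU h k : linext h << k >> = h k.
Proof. by rewrite (@linextEw _ _ _ msuppU_le) big_seq_fset1 mcoeffUU scale1r. Qed.

Lemma linext_is_linear h : linear (linext h).
Proof.
move=> a x y; pose d := (msupp (a *: x + y) `|` (msupp x `|` msupp y))%fset.
rewrite !(@linextEw _ d _) ?fsubsetUl //; last 2 first.
- by rewrite /d fsubsetU // fsubsetUr orbT.
- by rewrite /d fsubsetU // fsubsetUl orbT.
rewrite scaler_sumr -big_split; apply: eq_bigr => k _ /=.
by rewrite mcoeffD mcoeffZ scalerDl scalerA.
Qed.

HB.instance Definition _ h :=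
  GRing.isLinear.Build rat {malg rat[K]} V *:%R (linext h) (linext_is_linear h).

Lemma malg_linearE (L : {linear {malg rat[K]} -> V}) x : L x = linext (fun k => L << k >>) x.
Proof.
rewrite {1}[x]monalgE raddf_sum; apply: eq_bigr => k _ /=.
rewrite -linearZ; congr (L _); apply/malgP => k'.
by rewrite mcoeffZ !mcoeffU mulrnAr mulr1.
Qed.

End LinearExtension.

Arguments linext {K V}.

Lemma tensE x y :
  tens x y = linext (fun m => linext (fun n => << ((m, n) : fpair) >>) y) x.
Proof.
apply: eq_bigr => m _; rewrite scaler_sumr; apply: eq_bigr => n _; rewrite scalerA.
by apply/malgP => k; rewrite mcoeffZ !mcoeffU mulrnAr mulr1.
Qed.

Lemma topE x y : top x y = linext (fun m => linext (ftop m) y) x.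
Proof.
apply: eq_bigr => m _; rewrite scaler_sumr; apply: eq_bigr => n _.
by rewrite scalerA.
Qed.

Lemma linext_DZ (K : choiceType) (V : lmodType rat) (h h1 h2 : K -> V) a x :
    (forall k, h k = a *: h1 k + h2 k) ->
  linext h x = a *: linext h1 x + linext h2 x.
Proof.
move=> hE; rewrite /linext scaler_sumr -big_split; apply: eq_bigr => k _ /=.
by rewrite hE scalerDr !scalerA mulrC.
Qed.

Lemma tens_linear_l y : linear (tens^~ y).
Proof. by move=> a x x'; rewrite /= !tensE; apply: linext_is_linear. Qed.

Lemma tens_linear_r x : linear (tens x).
Proof.
move=> a y y'; rewrite (tensE x y) (tensE x y') (tensE x (a *: y + y')).
by apply: linext_DZ => m; apply: linext_is_linear.
Qed.

Lemma top_linear_l y : linear (top^~ y).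
Proof.
move=> a x x'; rewrite /= (topE x y) (topE x' y) (topE (a *: x + x') y).
exact: linext_is_linear.
Qed.

Definition tensl y x := tens x y.
HB.instance Definition _ y :=
  GRing.isLinear.Build rat HR HR2 *:%R (tensl y) (tens_linear_l y).
HB.instance Definition _ x :=
  GRing.isLinear.Build rat HR HR2 *:%R (tens x) (tens_linear_r x).

Lemma Delta_linear : linear Delta.
Proof. exact: (@linext_is_linear _ _ Delta_forest). Qed.

HB.instance Definition _ := GRing.isLinear.Build rat HR HR2 *:%R Delta Delta_linear.

Lemma Delta_red_linear : linear Delta_red.
Proof. exact: (linearP (Delta \- tens 1 \- tensl 1)). Qed.

HB.instance Definition _ := GRing.isLinear.Build rat HR HR2 *:%R Delta_red Delta_red_linear.

Lemma tensU m n : tens << m >> << n >> = << ((m, n) : fpair) >>.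
Proof. by rewrite tensE !linextU. Qed.

Lemma topU m x : top << m >> x = linext (ftop m) x.
Proof. by rewrite topE linextU. Qed.

Lemma DeltaU m : Delta << m >> = Delta_forest m.
Proof. exact: linextU. Qed.

Lemma tens1U m : tens 1 << m >> = << ((mone, m) : fpair) >>.
Proof. exact: (tensU mone). Qed.

Lemma tensU1 m : tens << m >> 1 = << ((m, mone) : fpair) >>.
Proof. exact: (tensU _ mone). Qed.

(** * The coproduct as a sum over all cuts *)

Lemma ucm_neq1 (t : ctree) : (ucm t : forest) != mone.
Proof. by rewrite cm1_eq1. Qed.

Lemma ucm_forest_of (t : ctree) : ucm t = forest_of [:: val t].
Proof. by rewrite forest_of_cons forest_of_nil mulm1 mkct_val. Qed.

(** The two terms outside the sum over admissible cuts are the empty cut, 1 (x) t, and the total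
    cut, t (x) 1. *)
Lemma Delta_treeE t : Delta_tree t = \sum_(c <- fcuts (ucm t)) << c >>.
Proof.
pose G x y : HR2 := << ((x, y) : fpair) >>.
transitivity (\sum_(c <- fcuts (ucm t)) G c.1 c.2); last by apply: eq_bigr => -[].
rewrite sum_fcuts_proper ?ucm_neq1 // [X in X + _]addrC.
congr (_ + _ + _); [exact: tens1U | exact: tensU1 |].
rewrite sum_admissible [RHS]big_mkcond.
rewrite ucm_forest_of.
rewrite (sum_fcuts (fun x y => if (x != mone) && (y != mone) then G x y else 0)).
rewrite (sum_cutsF_seq1 (fun x y => if (forest_of x != mone) && (forest_of y != mone)
                           then G (forest_of x) (forest_of y) else 0)).
rewrite -big_mkcond; apply: eq_bigl => c.
by rewrite !forest_of_eq1.
Qed.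

Lemma mul_malgU (x y : fpair) :
  << x >> * << y >> = << ((mmul x.1 y.1, mmul x.2 y.2) : fpair) >> :> HR2.
Proof. by rewrite malgM_def fgmulUU mulr1. Qed.

Lemma Delta_forestE m : Delta_forest m = \sum_(c <- fcuts m) << c >>.
Proof.
pose G x y : HR2 := << ((x, y) : fpair) >>.
transitivity (\sum_(c <- fcuts m) G c.1 c.2); last by apply: eq_bigr => -[].
rewrite /Delta_forest -{2}(planarK m) sum_fcuts /planar.
elim: (trees_of m) => [|t ts IH].
  rewrite big_nil (sum_cutsF_nil (fun x y => G (forest_of x) (forest_of y))).
  by rewrite forest_of_nil.
rewrite big_cons IH map_cons.
rewrite (sum_cutsF_cat (fun x y => G (forest_of x) (forest_of y)) [:: _]).
have -> : Delta_tree t = \sum_(a <- cutsF [:: val t]) G (forest_of a.1) (forest_of a.2).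
  by rewrite -(sum_fcuts G) -ucm_forest_of Delta_treeE; apply: eq_bigr => -[].
rewrite mulr_suml; apply: eq_bigr => a _; rewrite mulr_sumr; apply: eq_bigr => b _.
by rewrite /G !forest_of_cat; apply: mul_malgU.
Qed.

Section LinearExtensionSums.
Variables (K : choiceType) (V W : lmodType rat).
Implicit Types (h : K -> V) (x : {malg rat[K]}).

Lemma linext_comp (L : {linear V -> W}) h x :
  L (linext h x) = linext (fun k => L (h k)) x.
Proof. by rewrite linear_sum; apply: eq_bigr => k _; rewrite linearZ. Qed.

Lemma linext_sum (I : Type) (r : seq I) (P : pred I) (h : I -> K -> V) x :
  \sum_(i <- r | P i) linext (h i) x = linext (fun k => \sum_(i <- r | P i) h i k) x.
Proof.
by rewrite /linext exchange_big; apply: eq_bigr => k _; rewrite scaler_sumr.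
Qed.

Lemma linextD (h1 h2 : K -> V) x :
  linext h1 x + linext h2 x = linext (fun k => h1 k + h2 k) x.
Proof. by rewrite /linext -big_split; apply: eq_bigr => k _; rewrite scalerDr. Qed.

Lemma eq_linext k0 h1 h2 x : x@_k0 = 0 -> (forall k, k != k0 -> h1 k = h2 k) ->
  linext h1 x = linext h2 x.
Proof.
move=> x0 h12; apply: eq_bigr => k _; have [->|/h12 -> //] := eqVneq k k0.
by rewrite x0 !scale0r.
Qed.

Lemma linext_coef k0 x : linext (fun k => (k == k0)%:R : rat^o) x = x@_k0.
Proof.
rewrite [in RHS](monalgE x) raddf_sum; apply: eq_bigr => k _ /=.
by rewrite mcoeffU -[RHS]mulr_natr.
Qed.

End LinearExtensionSums.

(** * The reduced coproduct and primitive elements *)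

Lemma Delta_redU m : m != mone ->
  Delta_red << m >> = \sum_(c <- fcuts m | proper_cut c) << c >>.
Proof.
move=> m1; pose G x y : HR2 := << ((x, y) : fpair) >>.
have DE : Delta << m >> = G m mone + G mone m + \sum_(c <- fcuts m | proper_cut c) G c.1 c.2.
  rewrite -sum_fcuts_proper // DeltaU Delta_forestE.
  by apply: eq_bigr => -[].
transitivity (\sum_(c <- fcuts m | proper_cut c) G c.1 c.2); last by apply: eq_bigr => -[].
transitivity (G m mone + G mone m + \sum_(c <- fcuts m | proper_cut c) G c.1 c.2 -
    G mone m - G m mone).
  by congr (_ - _ - _); [exact: DE | exact: tens1U | exact: tensU1].
by apply/eqP; rewrite !subr_eq addrC addrA.
Qed.

Lemma Delta_red_one : Delta_red << mone >> = - << ((mone, mone) : fpair) >>.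
Proof.
have DE : Delta << mone >> = << ((mone, mone) : fpair) >>.
  rewrite DeltaU Delta_forestE -forest_of_nil.
  pose G x y : HR2 := << ((x, y) : fpair) >>.
  transitivity (\sum_(c <- fcuts (forest_of [::])) G c.1 c.2); first by apply: eq_bigr => -[].
  by rewrite (sum_fcuts G) (sum_cutsF_nil (fun x y => G (forest_of x) (forest_of y))).
pose o : HR2 := << ((mone, mone) : fpair) >>.
transitivity (o - o - o); last by rewrite subrr sub0r.
by congr (_ - _ - _); [exact: DE | exact: tens1U | exact: tensU1].
Qed.

(** The reduced coproduct of 1 is -1 (x) 1, and a proper cut never produces 1 (x) 1. Hence this
    coefficient detects the constant term, which must vanish for a primitive element. *)
Lemma Delta_red_one_coef m :
  (Delta_red << m >>)@_((mone, mone) : fpair) = - (m == mone)%:R.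
Proof.
have [->|m1] := eqVneq m mone; last first.
  rewrite Delta_redU // raddf_sum big1 ?oppr0 //= => c /andP[c1 c2].
  rewrite mcoeffU; have [c0|//] := eqVneq c ((mone, mone) : fpair).
  by rewrite c0 eqxx in c1.
by rewrite Delta_red_one mcoeffN mcoeffUU.
Qed.

Lemma Delta_redE p : Delta_red p = linext (fun m => Delta_red << m >>) p.
Proof. exact: (malg_linearE Delta_red). Qed.

Lemma primitive_coef1 p : primitive p -> p@_mone = 0.
Proof.
move=> /eqP p0; apply/eqP; rewrite -oppr_eq0; apply/eqP.
transitivity ((Delta_red p)@_((mone, mone) : fpair)); last by rewrite p0 mcoeff0.
rewrite Delta_redE /linext raddf_sum -(linext_coef mone p) /linext -sumrN.
by apply: eq_bigr => m _ /=; rewrite mcoeffZ Delta_red_one_coef mulrN.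
Qed.

(** Obtained by applying the linear extension of [h] to the equation [Delta_red p = 0]. In this form
    a single monomial of [p] may well have proper cuts; only their combined contribution cancels. *)
Lemma primitive_sum (V : lmodType rat) (h : forest -> forest -> V) p : primitive p ->
  linext (fun m => \sum_(c <- fcuts m | proper_cut c) h c.1 c.2) p = 0.
Proof.
move=> pp; have p1 := primitive_coef1 _ pp; move: pp => /eqP pp.
pose H (c : fpair) := h c.1 c.2.
transitivity (linext H (Delta_red p)); last by rewrite pp linear0.
rewrite Delta_redE (linext_comp (linext H)).
apply: (@eq_linext _ _ mone) => // m m1; rewrite Delta_redU // raddf_sum.
by apply: eq_bigr => c _; rewrite [RHS]linextU.
Qed.

(** * Products whose right factor is primitive *)

Lemma graftsF_nil s k : k \in graftsF [::] s -> k = s.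
Proof.
elim/rforest_ind: s k => [|ts IHts|t s IHt IHs] k //.
  rewrite graftsF_cons cats0 graftsE cats0 => /mapP[x + ->].
  by rewrite inE => /orP[/eqP->|/mapP[y /IHts -> ->]].
rewrite graftsF_cons mem_cat => /orP[/mapP[x xt ->]|/mapP[r /IHs -> ->] //].
suff [->] : [:: x] = [:: t] by [].
by apply: IHt; rewrite graftsF_cons cats0 map_f.
Qed.

Lemma size_graftsF ms s : size (graftsF ms s) = (\sum_(t <- s) tweight t)%N.
Proof.
elim/rforest_ind: s => [|ts IHts|t s IHt IHs]; first by rewrite big_nil.
  by rewrite graftsF_cons cats0 size_map graftsE /= size_map big_seq1 tweight_node IHts.
rewrite graftsF_cons size_cat size_map big_cons -IHs size_map; congr (_ + _)%N.
by move: IHt; rewrite graftsF_cons cats0 size_map big_seq1.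
Qed.

(** Grafting the empty forest at any vertex returns [n], and [ftop] averages over exactly
    [fweight n] such terms. *)
Lemma ftop1m n : n != mone -> ftop mone n = << n >>.
Proof.
move=> n1; rewrite ftopE -{2}(planarK n) -forest_of_nil sum_fgrafts.
have -> : \sum_(k <- graftsF [::] (planar n)) (<< forest_of k >> : HR) =
          \sum_(k <- graftsF [::] (planar n)) << n >>.
  by apply: eq_big_seq => k /graftsF_nil ->; rewrite planarK.
rewrite big_const_seq count_predT size_graftsF fweight_planar iter_addr_0.
rewrite -scaler_nat scalerA mulVf ?scale1r // pnatr_eq0 fweight_eq0 //.
Qed.

Lemma linext_id (K : choiceType) (x : {malg rat[K]}) : linext (fun k => << k >>) x = x.
Proof.
apply: etrans (esym (monalgE x)); apply: eq_bigr => k _; apply/malgP => k'.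
by rewrite mcoeffZ !mcoeffU mulrnAr mulr1.
Qed.

Lemma top1 p : primitive p -> top << mone >> p = p.
Proof.
move=> pp; rewrite topU -[RHS]linext_id.
by apply: (@eq_linext _ _ mone) => [|n n1]; [exact: primitive_coef1 | rewrite ftop1m].
Qed.

Definition tens_top (p : HR) (a b : forest) : HR2 := tens << a >> (top << b >> p).

Lemma tens_topE p a b :
  tens_top p a b =
  linext (fun n => (fweight n)%:R^-1 *: \sum_(k <- fgrafts b n) << ((a, k) : fpair) >>) p.
Proof.
rewrite /tens_top topU (linext_comp (tens << a >>)); apply: eq_bigr => n _.
congr (_ *: _); rewrite ftopE linearZ linear_sum; congr (_ *: _).
by apply: eq_bigr => k _; apply: tensU.
Qed.

Lemma tens_top_oneE p b :
  tens (top << b >> p) << mone >> =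
  linext (fun n => (fweight n)%:R^-1 *: \sum_(k <- fgrafts b n) << ((k, mone) : fpair) >>) p.
Proof.
rewrite topU -[LHS]/(tensl << mone >> _) (linext_comp (tensl << mone >>)).
apply: eq_bigr => n _; congr (_ *: _); rewrite ftopE linearZ linear_sum; congr (_ *: _).
by apply: eq_bigr => k _; apply: tensU.
Qed.

(* Dividing by [fweight n] is harmless because every cut of [n] splits the weight:
   [fweight n] may be replaced by a function of the two halves. *)
Lemma primitive_sum_div (V : lmodType rat) (h : forest -> forest -> V) p : primitive p ->
  linext (fun n => (fweight n)%:R^-1 *: \sum_(c <- fcuts n | proper_cut c) h c.1 c.2) p = 0.
Proof.
move=> pp.
rewrite -[RHS](@primitive_sum _ (fun a b => (fweight a + fweight b)%:R^-1 *: h a b) p pp).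
apply: eq_bigr => n _; congr (_ *: _); rewrite scaler_sumr big_seq_cond [RHS]big_seq_cond.
by apply: eq_bigr => c /andP[/fcuts_weight -> _].
Qed.

Lemma Delta_top m p : primitive p ->
  Delta (top << m >> p) =
  tens (top << m >> p) << mone >> + \sum_(d <- fcuts m) tens_top p d.1 d.2.
Proof.
move=> pp; rewrite {1}topU (linext_comp Delta) tens_top_oneE.
under [in RHS]eq_bigr => d _ do rewrite tens_topE.
rewrite linext_sum linextD.
(* [G a b] collects the cuts of the graftings of [m] onto [n] that restrict to the cut [(a, b)] of
   [n]. *)
pose G a b : HR2 := \sum_(k <- fgrafts m a) << ((k, b) : fpair) >> +
  \sum_(d <- fcuts m) \sum_(k <- fgrafts d.2 b) << ((mmul a d.1, k) : fpair) >>.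
(* The added zero is the contribution of the proper cuts of the monomials of [p]. With it, the
   identity can be checked one monomial at a time. *)
rewrite -[RHS]addr0 -[X in _ = _ + X](@primitive_sum_div _ G p pp) linextD.
apply: (@eq_linext _ _ mone) => [|n n1]; first exact: primitive_coef1.
rewrite -scaler_sumr -!scalerDr ftopE linearZ linear_sum; congr (_ *: _).
transitivity (\sum_(k <- fgrafts m n) \sum_(c <- fcuts k) (<< ((c.1, c.2) : fpair) >> : HR2)).
  apply: eq_bigr => k _; apply: etrans (DeltaU k) _; rewrite Delta_forestE.
  by apply: eq_bigr => -[].
rewrite (fcuts_fgrafts m n (fun x y => << ((x, y) : fpair) >>)).
rewrite (sum_fcuts_proper n G n1); congr (_ + _ + _).
  by rewrite /G [X in _ + X]big1 ?addr0 // => d _; rewrite fgrafts_one big_nil.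
rewrite /G fgrafts_one big_nil add0r; apply: eq_bigr => d _; apply: eq_bigr => k _.
by rewrite mul1m.
Qed.

Lemma cancel_ends (V : zmodType) (a b c d : V) : a + (b + c + d) - c - a = b + d.
Proof. by apply/eqP; rewrite !subr_eq (addrAC b c) addrA (addrC a). Qed.

(** Among the cuts of [m], the total one gives m (x) (1 top p) = m (x) p, and the empty one gives 1
    (x) (m top p), which the reduction removes. *)
Lemma Delta_red_top m p : m != mone -> primitive p ->
  Delta_red (top << m >> p) =
  tens << m >> p + \sum_(d <- fcuts m | proper_cut d) tens_top p d.1 d.2.
Proof.
move=> m1 pp.
have DT : Delta (top << m >> p) = tens (top << m >> p) << mone >> +
    (tens_top p m mone + tens_top p mone m +
     \sum_(d <- fcuts m | proper_cut d) tens_top p d.1 d.2).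
  by rewrite -(sum_fcuts_proper m (tens_top p) m1); apply: Delta_top.
have -> : tens << m >> p = tens_top p m mone by rewrite /tens_top top1.
have DR x : Delta_red x = Delta x - tens << mone >> x - tens x << mone >> by [].
by apply: etrans (DR _) _; rewrite DT; apply: cancel_ends.
Qed.

(** [Fmap (x :: ps)] seen as a linear function of its first factor [x], which may then be any
    element, such as a forest. *)
Definition foldtop (ps : seq HR) (x : HR) : HR := foldl top x ps.

Lemma foldtop_linear ps : linear (foldtop ps).
Proof.
elim: ps => [|p ps IHps] a x y //; rewrite /foldtop /=.
by rewrite (top_linear_l p a x y); apply: IHps.
Qed.

HB.instance Definition _ ps :=
  GRing.isLinear.Build rat HR HR *:%R (foldtop ps) (foldtop_linear ps).

(** * The recursion for the projection, by induction on the weight *)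

Section Projection.
Variable pi1 : {linear HR -> HR}.
Hypothesis pi1_prim : forall p : HR, primitive p -> pi1 p = p.
Hypothesis pi1_Fmap : forall ps : seq HR,
  (2 <= size ps)%N -> all primitive ps -> pi1 (Fmap ps) = 0.

Definition cut_sum (m : forest) : HR :=
  \sum_(c <- fcuts m | proper_cut c) top << c.1 >> (pi1 << c.2 >>).

(* The third clause replaces membership of [<< m >>] in the span of the Im(F_j),
   j >= 1: only the vanishing of pi1 on iterated products with primitives matters. *)
Definition pi1_formula (m : forest) :=
  [/\ pi1 << m >> = << m >> - cut_sum m,
      Delta_red (pi1 << m >>) = 0 &
      forall ps, (0 < size ps)%N -> all primitive ps -> pi1 (foldtop ps << m >>) = 0].

Lemma proper_cut_weight m c : c \in fcuts m -> proper_cut c ->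
  (fweight c.1 < fweight m)%N && (fweight c.2 < fweight m)%N.
Proof.
move=> /fcuts_weight <- /andP[]; rewrite -!fweight_eq0 -!lt0n => c1 c2.
by rewrite -[X in (X < _)%N]addn0 ltn_add2l c2 -[X in (X < _)%N]add0n ltn_add2r c1.
Qed.

Lemma Delta_red_sub_cut_sum m : m != mone ->
    (forall c, c \in fcuts m -> proper_cut c -> pi1_formula c.2) ->
  Delta_red (<< m >> - cut_sum m) = 0.
Proof.
move=> m1 IH.
have E : Delta_red (cut_sum m) = \sum_(c <- fcuts m | proper_cut c) << c >>.
  rewrite /cut_sum linear_sum.
  transitivity (\sum_(c <- fcuts m | proper_cut c) (tens << c.1 >> (pi1 << c.2 >>) +
      \sum_(d <- fcuts c.1 | proper_cut d) tens << d.1 >> (top << d.2 >> (pi1 << c.2 >>)))).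
    rewrite big_seq_cond [RHS]big_seq_cond; apply: eq_bigr => c /andP[cm cp].
    have [_ /eqP pc _] := IH c cm cp; have /andP[c1 _] := cp.
    exact: Delta_red_top.
  rewrite big_split.
  (* The inner cut moves from the removed part to the trunk, where its sum is [cut_sum c.2]; the
     formula for [c.2] then adds it to [pi1 << c.2 >>] to give [c.2] itself. *)
  rewrite (fcuts_coassoc_proper m (fun x y z => tens << x >> (top << y >> (pi1 << z >>)))).
  rewrite -big_split big_seq_cond [RHS]big_seq_cond; apply: eq_bigr => c /andP[cm cp].
  have [pE _ _] := IH c cm cp.
  rewrite /= -(linear_sum (tens << c.1 >>)) -(linearD (tens << c.1 >>)).
  have cE : pi1 << c.2 >> + cut_sum c.2 = << c.2 >> by rewrite pE subrK.
  apply: etrans (congr1 (tens << c.1 >>) cE) _; apply: etrans (tensU _ _) _.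
  by rewrite -surjective_pairing.
apply: etrans (linearB Delta_red _ _) _.
by rewrite /= E Delta_redU // subrr.
Qed.

Lemma pi1_formulaP m : m != mone -> pi1_formula m.
Proof.
have [n] := ubnP (fweight m); elim: n m => // n IHn m mn m1.
have IH c : c \in fcuts m -> proper_cut c -> pi1_formula c.1 /\ pi1_formula c.2.
  move=> cm cp; have /andP[w1 w2] := @proper_cut_weight m c cm cp; have /andP[c1 c2] := cp.
  by split; apply: IHn => //; [apply: leq_trans w1 mn | apply: leq_trans w2 mn].
have /eqP pq : Delta_red (<< m >> - cut_sum m) = 0.
  by apply: Delta_red_sub_cut_sum => // c cm cp; have [] := IH c cm cp.
have mE : << m >> = (<< m >> - cut_sum m) + cut_sum m :> HR by rewrite subrK.
(* A summand [c.1] top [pi1 c.2] followed by [ps] is [c.1] followed by the nonempty list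
   [pi1 c.2 :: ps] of primitives, so the third clause for [c.1] applies. The empty [ps] is allowed
   here and gives [pi1 (cut_sum m) = 0]. *)
have fold0 ps : all primitive ps -> pi1 (foldtop ps (cut_sum m)) = 0.
  move=> pps; rewrite /cut_sum !linear_sum big_seq_cond big1 // => c /andP[cm cp].
  have [[_ _ f1] [_ /eqP p2 _]] := IH c cm cp.
  by apply: (f1 (pi1 << c.2 >> :: ps)) => //=; rewrite pps andbT.
have piE : pi1 << m >> = << m >> - cut_sum m.
  by rewrite [in LHS]mE linearD (pi1_prim _ pq) (fold0 [::]) ?addr0.
split=> [//||ps ps0 pps]; first by rewrite piE; apply/eqP.
(* What remains is an iterated product of at least two primitives, headed by
   [<< m >> - cut_sum m]. *)
rewrite [in LHS]mE (linearD (foldtop ps)) (linearD pi1) fold0 // addr0.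
by apply: (pi1_Fmap (_ :: ps)) => //=; rewrite pps andbT.
Qed.

End Projection.

Lemma top_pi_sum (pi1 : HR -> HR) (r : seq fpair) (P : pred fpair) :
  top_pi pi1 (\sum_(c <- r | P c) << c >>) =
  \sum_(c <- r | P c) top << c.1 >> (pi1 << c.2 >>).
Proof.
pose h (c : fpair) := top << c.1 >> (pi1 << c.2 >>).
rewrite -[LHS]/(linext h _) linear_sum; apply: eq_bigr => c _.
exact: linextU.
Qed.

(* pi1 : the projection of H_R onto Im(F_1) = Prim(H_R) along
   Q1 (+) (+)_{j>=2} Im(F_j). *)
Theorem theorem9p6 (pi1 : {linear HR -> HR}) :
  pi1 1 = 0 ->
  (forall p : HR, primitive p -> pi1 p = p) ->
  (forall ps : seq HR, (2 <= size ps)%N -> all primitive ps -> pi1 (Fmap ps) = 0) ->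
  forall F : forest, F != mone ->
    pi1 << F >> = << F >> - top_pi pi1 (Delta_red << F >>).
Proof.
move=> _ pi1_prim pi1_Fmap F F1; rewrite Delta_redU // top_pi_sum.
by have [] := @pi1_formulaP pi1 pi1_prim pi1_Fmap F F1.
Qed.
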